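(* Let $p$ be a prime, let $K/\mathbb Q_p$ be a finite extension with ring of integers $\mathcal O_K$ and maximal ideal $\mathfrak m_K$, fix an algebraic closure $\overline K$ of $K$, and let $K^{\rm ur}\subset\overline K$ be the maximal unramified extension of $K$. Let $f\in\mathcal O_K[X]$ be monic of degree $d\geq 2$ with $f'(X)\in\mathfrak m_K\mathcal O_K[X]$. Let $t_0\in\mathcal O_K$ and let $(t_n)_{n\geq 0}$ be a sequence in $\overline K$ with $f(t_{n+1})=t_n$ for all $n\geq 0$. Put $K_n:=K(t_n)$, $K_\infty:=\bigcup_{n\geq 0}K_n$, $E_n:=K_n\cap K^{\rm ur}$ and $e_n:=[K_n:E_n]$. If $K_\infty/K$ is not unramified, then the sequence $(e_n)_{n\ge 0}$ is unbounded.
   Context: An algebraic extension of $K$ is unramified if every finite subextension is unramified; here $K_\infty/K$ is unramified if and only if $e_n=1$ for all $n$. The extension $E_n/K$ is unramified and $K_n/E_n$ is totally ramified, so $e_n$ is the ramification index of $K_n/K$. *)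

(* Defs.v *)
From HB Require Import structures.
From mathcomp Require Import all_boot all_order all_algebra all_field.
From mathcomp Require Import boolp classical_sets.

Set Implicit Arguments.
Unset Strict Implicit.
Unset Printing Implicit Defensive.

Import Order.TTheory GRing.Theory Num.Theory.
Local Open Scope ring_scope.
Local Open Scope classical_set_scope.

(* Z_p = lim Z/p^n.  The n-th component is the representative in [0, p^n[ of  *)
(* a class mod p^n: the equation below says both that x n is reduced mod p^n  *)
(* and that x n.+1 maps to x n.  The primality proof is a phantom parameter,  *)
(* needed only for Z_p to be a domain.                                        *)
Definition coherent (p : nat) (x : nat -> int) : Prop :=
  forall n, x n = (x n.+1 %% (p ^ n)%:Z)%Z.

Record padic_int (p : nat) (p_pr : prime p) := PadicInt {
  padic_seq :> nat -> int;
  padic_coherent : coherent p padic_seq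
}.

Section PadicInt.
Variables (p : nat) (p_pr : prime p).
Local Notation Zp := (padic_int p_pr).
Local Notation q n := ((p ^ n)%:Z).

HB.instance Definition _ := gen_eqMixin Zp.
HB.instance Definition _ := gen_choiceMixin Zp.

Lemma padicP (x y : Zp) : (forall n, x n = y n) -> x = y.
Proof.
case: x y => [x hx] [y hy] /= /funext exy; move: hx hy; rewrite exy => hx hy.
by congr PadicInt; apply: Prop_irrelevance.
Qed.

Lemma padic_mod (x : Zp) n : (x n %% q n)%Z = x n.
Proof. by rewrite (padic_coherent x n) modz_mod. Qed.

Lemma modz_pow (a : int) m n :
  (m <= n)%N -> ((a %% q n)%Z %% q m)%Z = (a %% q m)%Z.
Proof.
move=> mn; rewrite [in RHS](divz_eq a (q n)).
have -> : q n = q (n - m)%N * q m by rewrite -PoszM -expnD subnK.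
by rewrite mulrA modzMDl.
Qed.

Lemma coherent_mod (a : nat -> int) :
    (forall n, (a n %% q n = a n.+1 %% q n)%Z) ->
  coherent p (fun n => (a n %% q n)%Z).
Proof. by move=> ha n; rewrite modz_pow // ha. Qed.

Definition padic_of (a : nat -> int) ha : Zp := PadicInt p_pr (@coherent_mod a ha).

Fact padic_const_subproof (c : int) n : (c %% q n = c %% q n)%Z.
Proof. by []. Qed.

Fact padic_opp_subproof (x : Zp) n : (- x n %% q n = - x n.+1 %% q n)%Z.
Proof. by rewrite (padic_coherent x n) modzNm. Qed.

Fact padic_add_subproof (x y : Zp) n :
  ((x n + y n) %% q n = (x n.+1 + y n.+1) %% q n)%Z.
Proof. by rewrite (padic_coherent x n) (padic_coherent y n) modzDm. Qed.

Fact padic_mul_subproof (x y : Zp) n :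
  ((x n * y n) %% q n = (x n.+1 * y n.+1) %% q n)%Z.
Proof. by rewrite (padic_coherent x n) (padic_coherent y n) modzMm. Qed.

Definition padic_const c : Zp := padic_of (padic_const_subproof c).
Definition padic_opp x : Zp := padic_of (padic_opp_subproof x).
Definition padic_add x y : Zp := padic_of (padic_add_subproof x y).
Definition padic_mul x y : Zp := padic_of (padic_mul_subproof x y).

Fact padic_addA : associative padic_add.
Proof. by move=> x y z; apply: padicP => n /=; rewrite modzDmr modzDml addrA. Qed.

Fact padic_addC : commutative padic_add.
Proof. by move=> x y; apply: padicP => n /=; rewrite addrC. Qed.

Fact padic_add0 : left_id (padic_const 0) padic_add.
Proof. by move=> x; apply: padicP => n /=; rewrite modzDml add0r padic_mod. Qed.

Fact padic_addN : left_inverse (padic_const 0) padic_opp padic_add.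
Proof. by move=> x; apply: padicP => n /=; rewrite modzDml addNr. Qed.

HB.instance Definition _ :=
  GRing.isZmodule.Build Zp padic_addA padic_addC padic_add0 padic_addN.

Fact padic_mulA : associative padic_mul.
Proof. by move=> x y z; apply: padicP => n /=; rewrite modzMmr modzMml mulrA. Qed.

Fact padic_mulC : commutative padic_mul.
Proof. by move=> x y; apply: padicP => n /=; rewrite mulrC. Qed.

Fact padic_mul1 : left_id (padic_const 1) padic_mul.
Proof. by move=> x; apply: padicP => n /=; rewrite modzMml mul1r padic_mod. Qed.

Fact padic_mulD : left_distributive padic_mul +%R.
Proof.
by move=> x y z; apply: padicP => n /=; rewrite modzMml modzDm mulrDl.
Qed.

Fact padic_1neq0 : padic_const 1 != 0.
Proof.
apply/eqP => /(congr1 (fun x : Zp => x 1%N)) /=.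
by rewrite expn1 mod0z !modz_small // ltz_nat prime_gt1.
Qed.

HB.instance Definition _ := GRing.Zmodule_isComNzRing.Build Zp
  padic_mulA padic_mulC padic_mul1 padic_mulD padic_1neq0.

Definition padic_unit : {pred Zp} := fun x => `[< exists y, y * x = 1 >].
Definition padic_inv (x : Zp) : Zp := xget x [set y | y * x = 1].

Fact padic_mulV : {in padic_unit, left_inverse 1 padic_inv *%R}.
Proof. by move=> x /asboolP[y yx]; rewrite /padic_inv; case: xgetP => // /(_ y). Qed.

Fact padic_unitP (x y : Zp) : y * x = 1 -> padic_unit x.
Proof. by move=> yx; apply/asboolP; exists y. Qed.

Fact padic_inv_out : {in [predC padic_unit], padic_inv =1 id}.
Proof.
move=> x /asboolP nx; rewrite /padic_inv; case: xgetP => // y _ yx.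
by case: nx; exists y.
Qed.

HB.instance Definition _ := GRing.ComNzRing_hasMulInverse.Build Zp
  padic_mulV padic_unitP padic_inv_out.

Lemma padic_le (x : Zp) m n : (m <= n)%N -> x m = (x n %% q m)%Z.
Proof.
elim: n => [|n IH]; first by rewrite leqn0 => /eqP->; rewrite padic_mod.
rewrite leq_eqVlt => /orP[/eqP->|mn]; first by rewrite padic_mod.
by rewrite IH // (padic_coherent x n) modz_pow.
Qed.

Lemma padic_neq0 (x : Zp) : x != 0 -> exists n, x n != 0.
Proof.
move=> x0; apply: contrapT => /forallNP h; move/eqP: x0; apply.
by apply: padicP => n; rewrite [RHS]/= mod0z; apply/eqP; apply: contrapT => /negP /h.
Qed.

Fact padic_idomain (x y : Zp) : x * y = 0 -> (x == 0) || (y == 0).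
Proof.
move=> xy0; apply: contrapT => /negP; rewrite negb_or => /andP[].
move=> /padic_neq0[a xa] /padic_neq0[b yb].
have /= := congr1 (fun z : Zp => z (a + b)%N) xy0.
rewrite mod0z => /dvdz_mod0P; rewrite dvdzE abszM !absz_nat.
have val_lt (z : Zp) m n : (m <= n)%N -> z m != 0 ->
    (0 < `|z n|)%N && (logn p `|z n| < m)%N.
  move=> mn; rewrite (padic_le z mn) => zn0.
  have z_gt0 : (0 < `|z n|)%N.
    by rewrite absz_gt0; apply: contraNneq zn0 => ->; rewrite mod0z.
  rewrite z_gt0 ltnNge -pfactor_dvdn //=; apply: contraNN zn0.
  by move=> dv; apply/eqP/dvdz_mod0P; rewrite dvdzE absz_nat.
have /andP[x_gt0 xlt] := val_lt x a (a + b)%N (leq_addr b a) xa.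
have /andP[y_gt0 ylt] := val_lt y b (a + b)%N (leq_addl a b) yb.
rewrite pfactor_dvdn ?muln_gt0 ?x_gt0 // lognM // leqNgt.
by rewrite (leq_trans _ (leq_add xlt (ltnW ylt))).
Qed.

HB.instance Definition _ := GRing.ComUnitRing_isIntegral.Build Zp padic_idomain.

Definition padic : fieldType := {fraction Zp}.
Definition padic_emb : {rmorphism Zp -> padic} := @tofrac Zp.

End PadicInt.

(* The rings of integers of K and of the subfields of an algebraic closure of *)
(* K are the integral closures of Z_p, given with its structural embedding j. *)
Section Integers.
Variables (p : nat) (p_pr : prime p) (F : fieldType).
Variable j : {rmorphism padic_int p_pr -> F}.
Implicit Types L : set F.

Definition integers L : set F := [set x | L x /\ integralOver j x].

(* [integers L] is a local ring: its maximal ideal consists of its nonunits.  *)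
Definition max_ideal L : set F :=
  [set x | integers L x /\ ~ exists2 y, integers L y & x * y = 1].

Definition ideal_span (A S : set F) : set F :=
  [set x | exists n (a s : 'I_n -> F),
    [/\ forall i, A (a i), forall i, S (s i) & x = \sum_i a i * s i]].

End Integers.

Section Extensions.
Variables (F : fieldType).
Implicit Types E L : set F.

Definition is_basis E L m (b : 'I_m -> F) : Prop :=
  (forall i, L (b i)) /\
  forall x, L x -> exists! a : {ffun 'I_m -> F},
    (forall i, E (a i)) /\ x = \sum_i a i * b i.

Definition finite_ext E L : Prop :=
  exists m (b : 'I_m -> F), is_basis E L b.

(* [L : E], with value 0 when L/E is infinite. *)
Definition degree E L : nat :=
  xget 0%N [set m | exists b : 'I_m -> F, is_basis E L b].

End Extensions.

Section Unramified.
Variables (p : nat) (p_pr : prime p) (K : fieldExtType (padic p_pr)).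
Variables (Kbar : fieldType) (iota : {rmorphism K -> Kbar}).
Implicit Types L M : set Kbar.

Definition base_emb : {rmorphism padic_int p_pr -> K} :=
  in_alg K \o padic_emb p_pr.
Definition closure_emb : {rmorphism padic_int p_pr -> Kbar} :=
  iota \o base_emb.

Definition subext L : Prop :=
  range iota `<=` L /\ GRing.divring_closed [in L].

Definition adjoin (S : set Kbar) : set Kbar := smallest subext S.

(* m_K O_L = m_L, i.e. e(L/K) = 1; residue fields are finite, so the residue  *)
(* extension is automatically separable.                                      *)
Definition finite_unramified L : Prop :=
  [/\ subext L, finite_ext (range iota) L &
    ideal_span (integers closure_emb L) (max_ideal closure_emb (range iota))
      = max_ideal closure_emb L].

Definition unramified M : Prop :=
  forall L, subext L -> finite_ext (range iota) L -> L `<=` M ->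
    finite_unramified L.

(* The compositum of all finite unramified subextensions of Kbar/K. *)
Definition max_unramified : set Kbar :=
  adjoin (\bigcup_(L in finite_unramified) L).

End Unramified.

(* Main.v *)
(* Let O be the integral closure of Z_p in Kbar. By Hensel's lemma it is a
   valuation ring, so K has a uniformizer pi, and K^ur is the field generated
   over K by the roots of unity of order prime to p, in which every nonunit of O
   is divisible by pi.

   Suppose e_n <= B for all n. Then t_n has degree at most B over K^ur and is
   congruent to some d in K^ur, so pi divides (t_n - d)^B; the same holds for
   every conjugate s of t_n over K^ur, with the same d, whence pi divides
   (s - t_n)^B. Since f' = 0 modulo pi, f x - f y = (x - y) w with w in the ideal
   (pi, x - y). So if s_{n+N} is a conjugate of t_{n+N} and s_m denotes its image
   under f^(n+N-m), each step from s_{m+1} - t_{m+1} to s_m - t_m gains a factor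
   whose B-th power is divisible by pi, and pi^N divides (s_n - t_n)^B. As t_n
   has finitely many conjugates and N is arbitrary, s_n = t_n for all choices of
   s_{n+N}, i.e. t_n is in K^ur; hence K_oo is unramified over K. *)

Require Import Defs.
From HB Require Import structures.
From mathcomp Require Import all_boot all_order all_algebra all_field.
From mathcomp Require Import boolp classical_sets ring zify.

Set Implicit Arguments.
Unset Strict Implicit.
Unset Printing Implicit Defensive.

Import Order.TTheory GRing.Theory Num.Theory.
Local Open Scope ring_scope.
Local Open Scope classical_set_scope.

(** * The p-adic integers and Hensel factorization *)

(** No valuation is constructed: orders are compared by divisibility in O, and v(x) >= v(pi) / B is
    written as pi | x^B. The exponent B comes from the value group: [E n] lies in K^ur, so t_n has
    degree at most B over K^ur, and K^ur has the values of K; in an equation of degree at most B for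
    a nonunit x, two terms of lowest order must balance, which forces B v(x) >= v(pi). The main
    obstacle is that K^ur, a compositum of extensions in which m_K generates the maximal ideal,
    needs a concrete description. Roots of unity of order N prime to p stay distinct in the residue
    field, so interpolation at them is invertible over O and creates no new order; they also
    represent every nonzero residue class of O, which is the origin of d. Conversely, an element of
    an unramified extension is a series in pi with such digits, but this series converges only in a
    completion. Completeness is used for Z_p alone, in Hensel's lemma; membership in a field is
    always proved through conjugates: an element equal to all its conjugates lies in the base. *)

Section PadicIntegers.
Variables (p : nat) (p_pr : prime p).
Local Notation Zp := (padic_int p_pr).
Local Notation q n := ((p ^ n)%:Z).
Local Notation pz := (p%:R : Zp).
Implicit Types (x y : Zp) (n k : nat).

Let p_gt0 : (0 < p)%N. Proof. exact: prime_gt0. Qed.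
Let q_neq0 n : q n != 0. Proof. by rewrite gt_eqF // ltz_nat expn_gt0 p_gt0. Qed.

Lemma padic_seqD x y n : (x + y) n = ((x n + y n) %% q n)%Z. Proof. by []. Qed.
Lemma padic_seqN x n : (- x) n = (- x n %% q n)%Z. Proof. by []. Qed.
Lemma padic_seqM x y n : (x * y) n = ((x n * y n) %% q n)%Z. Proof. by []. Qed.

Lemma padic_seqB x y n : (x - y) n = ((x n - y n) %% q n)%Z.
Proof. by rewrite padic_seqD padic_seqN modzDmr. Qed.

Lemma padic_seq_nat m n : (m%:R : Zp) n = (m%:Z %% q n)%Z.
Proof.
elim: m => [|m IH] //.
by rewrite -addn1 natrD padic_seqD IH [(1 : Zp) n]/= modzDm -PoszD.
Qed.

Lemma padic_dvdP x n : x n = 0 <-> exists y, x = pz ^+ n * y.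
Proof.
split=> [xn0|[y ->]]; last first.
  by rewrite -natrX padic_seqM padic_seq_nat modzz mul0r mod0z.
have dv k : (q n %| x (n + k)%N)%Z.
  by apply/dvdz_mod0P; rewrite -padic_le ?leq_addr.
(* Division by p^n costs n digits, so component k of the quotient is read off at level n + k. *)
have co k : ((x (n + k)%N %/ q n)%Z %% q k = (x (n + k.+1)%N %/ q n)%Z %% q k)%Z.
  apply/eqP; rewrite eqz_mod_dvd -(@dvdz_mul2l (q n)) ?q_neq0 //.
  rewrite mulrBr -!(mulrC (_ %/ _)%Z) !divzK // -PoszM -expnD addnS.
  by rewrite -eqz_mod_dvd {1}(padic_coherent x (n + k)) modz_mod.
exists (padic_of p_pr co); apply: padicP => k.
rewrite -natrX padic_seqM padic_seq_nat /= modzMml modzMmr mulrC.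
have -> : (x (n + k) %/ q n)%Z * q n = x (n + k)%N by rewrite divzK.
by rewrite -padic_le ?leq_addl.
Qed.

Lemma padic_nat_unit x : x 1%N != 0 -> x \is a GRing.unit.
Proof.
move=> x1.
have cop n : coprimez (x n) (q n).
  case: n => [|n]; first by rewrite /coprimez gcdz1.
  rewrite coprimezE absz_nat coprime_sym coprimeXl // prime_coprime //.
  apply: contraNN x1 => dv; rewrite (@padic_le _ _ x 1 n.+1) // expn1.
  by apply/eqP/dvdz_mod0P; rewrite dvdzE.
have inv n : exists a : int, (a * x n %% q n = 1 %% q n)%Z.
  have /coprimezP[[u v] /= uv] := cop n.
  by exists u; rewrite -uv -modzDmr modzMl addr0.
have [a ha] := choice inv.
(* Inverses modulo p^n are unique, so any choice of them is coherent. *)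
have co n : (a n %% q n = a n.+1 %% q n)%Z.
  apply/eqP; rewrite eqz_mod_dvd -(@Gauss_dvdzl _ _ (x n)); last first.
    by rewrite coprimez_sym.
  rewrite mulrBl -eqz_mod_dvd ha.
  rewrite {1}(padic_coherent x n) modzMmr.
  by rewrite -(@modz_pow p (_ * _) n n.+1) ?ha ?modz_pow.
apply/unitrP; exists (padic_of p_pr co).
suff h : padic_of p_pr co * x = 1 by split => //; rewrite mulrC.
by apply: padicP => n; rewrite padic_seqM /= modzMml ha.
Qed.

Lemma padic_unitE x : (x \is a GRing.unit) = (x 1%N != 0).
Proof.
apply/idP/idP => [/unitrP[y [yx _]]|]; last exact: padic_nat_unit.
apply/eqP => x1; have := congr1 (fun z : Zp => z 1%N) yx.
rewrite padic_seqM x1 mulr0 mod0z /= modz_small // expn1.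
by rewrite ltz_nat prime_gt1.
Qed.

Lemma padic_factor x : x != 0 ->
  exists n u, u \is a GRing.unit /\ x = pz ^+ n * u.
Proof.
move=> /padic_neq0 xn; case: (ex_minnP xn) => -[|m] xm min_m.
  by move: xm; rewrite -padic_mod modz1.
have /padic_dvdP[u xE] : x m = 0.
  by apply/eqP; apply: contraT => /min_m; rewrite ltnn.
exists m, u; split=> //; rewrite padic_unitE; apply: contraNneq xm => u1.
have /padic_dvdP[v uE] : u 1%N = 0 by [].
apply/eqP/padic_dvdP; exists v; by rewrite xE uE expr1 mulrA -exprSr.
Qed.

Lemma padic_infinite_dvd x : (forall n, exists y, x = pz ^+ n * y) -> x = 0.
Proof. by move=> h; apply: padicP => n; rewrite (padic_dvdP x n).2 //= mod0z. Qed.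

Lemma padic_complete (a : nat -> Zp) :
    (forall j, exists c, a j.+1 = a j + pz ^+ j * c) ->
  exists l, forall j, exists c, l = a j + pz ^+ j * c.
Proof.
move=> ha.
have co j : (a j j %% q j = a j.+1 j.+1 %% q j)%Z.
  rewrite padic_mod -(@padic_le _ _ (a j.+1) j j.+1) //.
  have [c ->] := ha j; rewrite padic_seqD.
  have -> : (pz ^+ j * c) j = 0 by apply/padic_dvdP; exists c.
  by rewrite addr0 padic_mod.
exists (padic_of p_pr co) => j.
have /padic_dvdP[c cE] : (padic_of p_pr co - a j) j = 0.
  by rewrite padic_seqB /= padic_mod subrr mod0z.
by exists c; rewrite -cE addrC subrK.
Qed.

Lemma poly_padic_dvd (A : {poly Zp}) n :
    (forall i, exists c, A`_i = pz ^+ n * c) ->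
  exists B, A = pz ^+ n *: B /\ (size B <= size A)%N.
Proof.
move=> /choice[c hc]; exists (\poly_(i < size A) c i); split; last exact: size_poly.
apply/polyP => i; rewrite coefZ coef_poly; case: ltnP => [_|h]; first exact: hc.
by rewrite mulr0 nth_default.
Qed.

(** The uniform bound on the sizes makes the coefficientwise limit a polynomial. *)
Lemma poly_padic_complete (A : nat -> {poly Zp}) n :
    (forall j, size (A j) <= n)%N ->
    (forall j, exists B, A j.+1 = A j + pz ^+ j *: B) ->
  exists2 L : {poly Zp}, (size L <= n)%N & forall j, exists B, L = A j + pz ^+ j *: B.
Proof.
move=> sA hA.
have /choice[l hl] : forall i, exists l, forall j, exists c, l = (A j)`_i + pz ^+ j * c.
  move=> i; apply: padic_complete => j; have [B ->] := hA j.
  by exists B`_i; rewrite coefD coefZ.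
exists (\poly_(i < n) l i) => [|j]; first exact: size_poly.
have [|B [BE _]] := @poly_padic_dvd (\poly_(i < n) l i - A j) j; last first.
  by exists B; rewrite -BE addrC subrK.
move=> i; rewrite coefB coef_poly; case: ltnP => h.
  by have [c ->] := hl i j; exists c; rewrite addrAC subrr add0r.
by exists 0; rewrite nth_default ?subr0 ?mulr0 // (leq_trans (sA j)).
Qed.

Lemma poly_padic_eq0 (A : {poly Zp}) :
  (forall n, exists B, A = pz ^+ n *: B) -> A = 0.
Proof.
move=> h; apply/polyP => i; rewrite coef0; apply: padic_infinite_dvd => n.
by have [B ->] := h n; exists B`_i; rewrite coefZ.
Qed.

Import Pdiv.Ring Pdiv.RingMonic.

Lemma size_rdivp_monic (R G : {poly Zp}) k n :
  G \is monic -> size G = k.+1 -> (size R <= n)%N -> (size (rdivp R G) <= n - k)%N.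
Proof.
move=> mG sG sR; have [->|h0] := eqVneq (rdivp R G) 0; first by rewrite size_poly0.
have e : size R = (size (rdivp R G) + k)%N.
  rewrite {1}(rdivp_eq mG R) size_polyDl ?size_Mmonic // sG ?addnS //.
  have : (size (rmodp R G) < size G)%N by rewrite ltn_rmodp monic_neq0.
  rewrite sG ltnS => /leq_ltn_trans; apply.
  by rewrite -[X in (X < _)%N]add0n ltn_add2r size_poly_gt0.
by rewrite leq_subRL -?e 1?addnC -?e // (leq_trans _ sR) // e leq_addl.
Qed.

(* Newton iteration on the approximate factorizations
   [P = G (1 + p T) + p ^ (j + 1) R], dividing the error [R] by [G]. *)
Lemma hensel_factor (P : {poly Zp}) k :
    P`_k = 1 -> (forall i, (k < i)%N -> P`_i \isn't a GRing.unit) ->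
  exists G H : {poly Zp},
    [/\ P = G * H, size G = k.+1 & (size H <= size P - k)%N].
Proof.
move=> Pk1 Pk; set n := size P.
have kn : (k < n)%N.
  by rewrite ltnNge; apply/negP => h; move/eqP: Pk1;
    rewrite nth_default // eq_sym oner_eq0.
pose good (G T R : {poly Zp}) j := [/\ G \is monic, size G = k.+1,
  (size T <= n - k)%N, (size R <= n)%N & P = G * (1 + pz *: T) + pz ^+ j.+1 *: R].
(* With R = h G + g, adding p^(j+1) g to G and p^j h to T absorbs R; the new error consists of the
   cross terms, which are divisible by p^(j+2). *)
pose step j (x : {poly Zp} * {poly Zp} * {poly Zp}) :=
  let: (G, T, R) := x in let g := rmodp R G in let h := rdivp R G in
  (G + pz ^+ j.+1 *: g, T + pz ^+ j *: h, - (g * T + pz ^+ j *: (g * h))).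
(* Modulo p all coefficients of [P] beyond degree k vanish, so [P] is congruent to the monic
   polynomial [take_poly k P + 'X^k]: this starts the iteration with T = 0. *)
have [R0 [R0E sR0]] : exists R0 : {poly Zp},
    P - (take_poly k P + 'X^k) = pz ^+ 1 *: R0 /\ (size R0 <= n)%N.
  have [|B [BE sB]] := @poly_padic_dvd (P - (take_poly k P + 'X^k)) 1.
    move=> i; rewrite coefB coefD coef_take_poly coefXn.
    have [ik|ki|->] := ltngtP i k; [| |by rewrite Pk1 add0r subrr; exists 0;
      rewrite mulr0].
      by exists 0; rewrite addr0 subrr mulr0.
    rewrite addr0 subr0; apply/padic_dvdP.
    by have := Pk i ki; rewrite padic_unitE negbK => /eqP.
  exists B; split=> //; apply: leq_trans sB _.
  rewrite (leq_trans (size_polyD _ _)) // geq_max leqnn size_polyN /=.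
  rewrite (leq_trans (size_polyD _ _)) // geq_max size_polyXn kn andbT.
  by rewrite (leq_trans (size_take_poly _ _)) // ltnW.
pose st := fix st j := if j is i.+1 then step i (st i)
  else (take_poly k P + 'X^k, 0, R0).
have st_good j : let: (G, T, R) := st j in good G T R j.
  elim: j => [|j] /=.
    split; rewrite ?size_poly0 // ?scaler0 ?addr0 ?mulr1.
    - by rewrite addrC monicE lead_coefDl ?lead_coefXn // size_polyXn ltnS
      size_take_poly.
    - by rewrite addrC size_polyDl size_polyXn // ltnS size_take_poly.
    - by rewrite -R0E addrC subrK.
  case: (st j) => [[G T] R] [mG sG sT sR PE] /=.
  have sg : (size (rmodp R G) <= k)%N by rewrite -ltnS -sG ltn_rmodp monic_neq0.
  have sh := size_rdivp_monic mG sG sR.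
  have sgj : (size (pz ^+ j.+1 *: rmodp R G) < size G)%N.
    by rewrite sG ltnS (leq_trans (size_scale_leq _ _)).
  have sM (A : {poly Zp}) : (size A <= n - k)%N -> (size (rmodp R G * A)%R <= n)%N.
    move=> sA; rewrite (leq_trans (size_mul_leq _ _)) //.
    by move: sg sA kn; move: (size (rmodp R G)) (size A) => a b; lia.
  split.
  - by rewrite monicE lead_coefDl // -monicE.
  - by rewrite size_polyDl.
  - rewrite (leq_trans (size_polyD _ _)) // geq_max sT.
    by rewrite (leq_trans (size_scale_leq _ _)).
  - rewrite size_polyN (leq_trans (size_polyD _ _)) // geq_max sM //.
    by rewrite (leq_trans (size_scale_leq _ _)) ?sM.
  - rewrite {1}PE {1}(rdivp_eq mG R).
    rewrite -!mul_polyC !rmorphXn /=.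
    by rewrite !exprS; ring.
have [|j|G sG hG] := @poly_padic_complete (fun j => (st j).1.1) k.+1.
- by move=> j; have := st_good j; case: (st j) => [[G T] R] [_ -> ].
- rewrite /=; case: (st j) => [[G T] R] /=; exists (pz *: rmodp R G).
  by rewrite scalerA -exprSr.
have [|j|T sT hT] := @poly_padic_complete (fun j => (st j).1.2) (n - k).
- by move=> j; have := st_good j; case: (st j) => [[? ?] ?] [].
- rewrite /=; case: (st j) => [[? ?] R] /=; eexists; reflexivity.
exists G, (1 + pz *: T); split.
- apply/eqP; rewrite -subr_eq0; apply/eqP; apply: poly_padic_eq0 => j.
  have := st_good j; have [U ->] := hG j; have [V ->] := hT j.
  case: (st j) => [[G' T'] R'] /= [_ _ _ _ {1}->].
  exists (pz *: R' - pz *: G' * V - U * (1 + pz *: (T' + pz ^+ j *: V))).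
  by rewrite -!mul_polyC !rmorphXn /= !exprS; ring.
(* The limit is only known to have size at most k + 1; its coefficient of degree k is 1 modulo p,
   hence nonzero. *)
- have [U GE] := hG 1%N; move: (st_good 1%N) GE; move: (st 1%N) => [[G' T'] R'] /= + GE.
  case=> mG sG' _ _ _; apply/eqP; rewrite eqn_leq sG /=.
  rewrite ltnNge; apply/negP => sGk.
  have := congr1 (fun A : {poly Zp} => A`_k) GE.
  rewrite /= nth_default // coefD coefZ.
  have -> : G'`_k = 1 by move: mG; rewrite monicE lead_coefE sG' => /eqP.
  move=> /(congr1 (fun z : Zp => z 1%N)).
  rewrite padic_seqD ((padic_dvdP _ 1).2 (ex_intro _ U`_k erefl)) addr0 padic_mod /=.
  by rewrite mod0z modz_small // expn1 ltz_nat prime_gt1.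
rewrite (leq_trans (size_polyD _ _)) // geq_max size_poly1 subn_gt0 kn.
by rewrite (leq_trans (size_scale_leq _ _)).
Qed.

End PadicIntegers.

(** * The integral closure of Z_p is a valuation ring *)

Lemma map_poly_poly (R R' : nzRingType) (j : {rmorphism R -> R'}) n (F : nat -> R) :
  map_poly j (\poly_(i < n) F i) = \poly_(i < n) j (F i).
Proof.
by apply/polyP => i; rewrite coef_map !coef_poly; case: (i < n)%N; rewrite /= ?raddf0.
Qed.

Section PadicPoly.
Variables (p : nat) (p_pr : prime p).
Local Notation Zp := (padic_int p_pr).
Local Notation pz := (p%:R : Zp).

Lemma padic_nat_neq0 n : (0 < n)%N -> (n%:R : Zp) != 0.
Proof.
move=> n0; apply/eqP => /(congr1 (fun z : Zp => z n)).
rewrite padic_seq_nat /= mod0z modz_small; last by rewrite ltz_nat ltn_expl ?prime_gt1.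
by move=> -[n_eq0]; rewrite n_eq0 in n0.
Qed.

Lemma padic_nonunitP (x : Zp) : x \isn't a GRing.unit -> exists y, x = pz * y.
Proof. by rewrite padic_unitE negbK => /eqP /padic_dvdP; rewrite expr1. Qed.

(** Induction on the valuation of one fixed nonzero coefficient, which drops each time p is taken
    out of the polynomial. *)
Lemma poly_padic_primitive (P : {poly Zp}) : P != 0 ->
  exists n (Q : {poly Zp}), P = pz ^+ n *: Q /\ exists i, Q`_i \is a GRing.unit.
Proof.
move=> P0; have lP : lead_coef P != 0 by rewrite lead_coef_eq0.
have [n [u [uU]]] := padic_factor lP; rewrite lead_coefE.
move: (size P).-1 => i; elim: n P {P0 lP} => [|n IH] P Pi.
  by exists 0%N, P; rewrite scale1r; split=> //; exists i; rewrite Pi mul1r.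
have [[j Pj]|noU] := pselect (exists j, P`_j \is a GRing.unit).
  by exists 0%N, P; rewrite scale1r; split=> //; exists j.
have [|B [BE _]] := @poly_padic_dvd _ _ P 1.
  move=> j; rewrite expr1; apply: padic_nonunitP.
  by apply/negP => Pj; apply: noU; exists j.
have [|m [Q [QE hQ]]] := IH B.
  apply: (mulfI (padic_nat_neq0 (prime_gt0 p_pr))).
  by move: Pi; rewrite BE coefZ expr1 exprS mulrA.
by exists m.+1, Q; split=> //; rewrite BE QE scalerA expr1 exprS.
Qed.

End PadicPoly.

Section ValuationRing.
Variables (p : nat) (p_pr : prime p) (E : fieldType).
Local Notation Zp := (padic_int p_pr).
Variable J : {rmorphism Zp -> E}.

(* As [dvO] is total (see [dvO_total]), [small] is the maximal ideal of the
   integral closure [O] of Z_p in [E]: it need not require [O x], and it contains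
   0 since [dvO 0 1] is false. *)
Definition dvO (a x : E) : Prop := exists2 u, integralOver J u & x = a * u.
Definition small (x : E) : Prop := ~ dvO x 1.

Hypothesis J_inj : injective J.
Hypothesis J_alg : forall x : E, exists2 P : {poly Zp}, P != 0 & root (map_poly J P) x.

Local Notation O := (integralOver J).
Local Notation pE := (p%:R : E).
Local Notation pz := (p%:R : Zp).

Lemma J_eq0 x : (J x == 0) = (x == 0).
Proof. by rewrite -(rmorph0 J) (inj_eq J_inj). Qed.

Lemma natr_neq0 n : (0 < n)%N -> (n%:R : E) != 0.
Proof. by move=> n0; rewrite -(rmorph_nat J) J_eq0 padic_nat_neq0. Qed.

Lemma p_neq0 : pE != 0. Proof. by rewrite natr_neq0 ?prime_gt0. Qed.

(* Take [P] primitive of minimal degree with root [x] and let [k] be the largest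
   index of a unit coefficient. If [k = 0] then [1 / x] is integral, if [k] is the
   degree of [P] then [x] is, and otherwise Hensel's lemma factors [P]. *)
Lemma O_valuation x : O x \/ O x^-1.
Proof.
pose good n := `[< exists P : {poly Zp}, [/\ P != 0,
  root (map_poly J P) x & size P = n] >].
have [|n /asboolP[P0 [P00 P0x sP0]] min_n] := @ex_minnP good.
  by have [P P0 Px] := J_alg x; exists (size P); apply/asboolP; exists P.
have min (Q : {poly Zp}) : Q != 0 -> root (map_poly J Q) x -> (n <= size Q)%N.
  by move=> Q0 Qx; apply: min_n; apply/asboolP; exists Q.
have [m [P1 [P0E [i P1i]]]] := poly_padic_primitive P00.
have Zpm : pz ^+ m != 0 by rewrite expf_neq0 // padic_nat_neq0 ?prime_gt0.
have unitb i' : `[< P1`_i' \is a GRing.unit >] -> (i' <= size P1)%N.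
  by move/asboolP => U; rewrite leqNgt; apply/negP => /ltnW h; move: U;
    rewrite nth_default ?unitr0.
have ex : exists i', `[< P1`_i' \is a GRing.unit >] by exists i; apply/asboolP.
case: (ex_maxnP ex unitb) => k /asboolP P1k k_max {unitb ex P1i i}.
pose P : {poly Zp} := (P1`_k)^-1 *: P1.
have uk : (P1`_k)^-1 != 0 by rewrite invr_eq0; apply: contraTneq P1k => ->;
  rewrite unitr0.
have Pk1 : P`_k = 1 by rewrite coefZ mulVr.
have Pk i : (k < i)%N -> P`_i \isn't a GRing.unit.
  move=> ki; rewrite coefZ unitrMr ?unitrV //; apply/negP => U.
  by have := k_max i (asboolT U); rewrite leqNgt ki.
have Px : root (map_poly J P) x.
  by move: P0x; rewrite P0E !map_polyZ /= !rootZ ?J_eq0 //.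
have sP : size P = n by rewrite -sP0 P0E !size_scale.
have P_neq0 : P != 0 by apply: contra_eq_neq Pk1 => ->; rewrite coef0 eq_sym oner_eq0.
have [k0|k_gt0] := posnP k.
  (* [Q] is the reciprocal polynomial of [P]; its leading coefficient is the constant term of [P],
     which is 1. *)
  right; pose Q := \poly_(i < n) P`_(n.-1 - i).
  have n_gt0 : (0 < n)%N by rewrite -sP size_poly_gt0.
  have [x0|x0] := eqVneq x 0; first by rewrite x0 invr0; apply: integral0.
  have Q1 : Q`_n.-1 = 1 by rewrite coef_poly prednK // leqnn subnn -k0.
  have sQ : size Q = n.
    by apply/eqP; rewrite size_poly_eq // subnn -k0 Pk1 oner_eq0.
  apply: (@integral_root_monic _ _ J _ (map_poly J Q)).
  - by rewrite monic_map // monicE lead_coefE sQ Q1.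
  - rewrite rootE map_poly_poly horner_poly.
    apply/eqP/(mulIf (expf_neq0 n.-1 x0)); rewrite mul0r mulr_suml.
    move/rootP: Px; rewrite (@horner_coef_wide _ n) ?size_map_poly_id0 ?sP //;
      last first.
      by rewrite J_eq0 lead_coef_eq0.
    rewrite (reindex_inj rev_ord_inj) /= => Px0; rewrite -[RHS]Px0;
      apply: eq_bigr => -[i ltin] _ /=.
    rewrite coef_map /=. 
    have -> : (n.-1 - i = n - i.+1)%N by rewrite -subn1 subnAC -subnDA addn1.
    rewrite -mulrA; congr (_ * _).
    have -> : n.-1 = (n - i.+1 + i)%N by lia.
    by rewrite exprD mulrCA -exprMn mulVf // expr1n mulr1.
  - by apply/integral_poly => i; rewrite coef_map; apply: integral_id.
have [kn|kn] := leqP n k.+1.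
  left; exists P => //; rewrite monicE lead_coefE sP.
  have -> // : n.-1 = k; last by rewrite Pk1.
  apply/eqP; rewrite eqn_leq -ltnS prednK ?kn -?sP ?size_poly_gt0 //=.
  rewrite -ltnS prednK ?size_poly_gt0 // ltnNge; apply/negP => h.
  by move: Pk1; rewrite nth_default // => /eqP; rewrite eq_sym oner_eq0.
have [G [H [PE sG sH]]] := hensel_factor Pk1 Pk.
move: P_neq0; rewrite PE mulf_eq0 negb_or => /andP[G0 H0].
(* Both factors are shorter than [P], and [x] is a root of one of them, against the minimality of
   n. *)
move: Px; rewrite PE rmorphM rootM => /orP[Gx|Hx].
  by have := min G G0 Gx; rewrite sG leqNgt kn.
have := leq_trans (min H H0 Hx) sH; rewrite sP leqNgt ltn_subrL k_gt0 /=.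
by rewrite (leq_trans _ kn).
Qed.

Lemma integral_exp x n : O x -> O (x ^+ n).
Proof.
by move=> Ox; elim: n => [|n IH]; rewrite ?expr0 ?exprS;
  [exact: integral1 | exact: integral_mul].
Qed.

Lemma integral_sum I (r : seq I) (P : pred I) (F : I -> E) :
  (forall i, P i -> O (F i)) -> O (\sum_(i <- r | P i) F i).
Proof.
by move=> h; elim/big_ind: _ => //; [exact: integral0 | exact: integral_add].
Qed.

Lemma integral_prod I (r : seq I) (P : pred I) (F : I -> E) :
  (forall i, P i -> O (F i)) -> O (\prod_(i <- r | P i) F i).
Proof.
by move=> h; elim/big_ind: _ => //; [exact: integral1 | exact: integral_mul].
Qed.

Lemma dvO_total a b : dvO a b \/ dvO b a.
Proof.
have [->|a0] := eqVneq a 0; first by right; exists 0; rewrite ?mulr0 //;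
  exact: integral0.
have [->|b0] := eqVneq b 0; first by left; exists 0; rewrite ?mulr0 //;
  exact: integral0.
have [h|h] := O_valuation (b / a).
  by left; exists (b / a) => //; rewrite mulrC divfK.
by right; exists (a / b); [rewrite -invf_div | rewrite mulrC divfK].
Qed.

Lemma dvO_refl a : dvO a a.
Proof.
by exists 1; rewrite ?mulr1 //; exact: integral1.
Qed.

Lemma dvO_trans b a c : dvO a b -> dvO b c -> dvO a c.
Proof.
by move=> [u Ou ->] [v Ov ->]; exists (u * v); rewrite ?mulrA //; exact: integral_mul.
Qed.

Lemma dvOD a x y : dvO a x -> dvO a y -> dvO a (x + y).
Proof.
by move=> [u Ou ->] [v Ov ->]; exists (u + v); rewrite ?mulrDr //; exact: integral_add.
Qed.

Lemma dvON a x : dvO a x -> dvO a (- x).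
Proof. by move=> [u Ou ->]; exists (- u); rewrite ?mulrN //; exact: integral_opp. Qed.
Lemma dvOB a x y : dvO a x -> dvO a y -> dvO a (x - y).
Proof. by move=> hx hy; apply: dvOD => //; apply: dvON. Qed.
Lemma dvO0 a : dvO a 0. Proof. by exists 0; rewrite ?mulr0 //; exact: integral0. Qed.
Lemma dvOM a b x y : dvO a x -> dvO b y -> dvO (a * b) (x * y).
Proof.
by move=> [u Ou ->] [v Ov ->]; exists (u * v); [exact: integral_mul | rewrite mulrACA].
Qed.

Lemma dvO1 x : dvO 1 x <-> O x.
Proof. by split=> [[u Ou ->]|Ox]; [rewrite mul1r | exists x; rewrite ?mul1r]. Qed.
Lemma dvO_mulr a x y : dvO a x -> O y -> dvO a (x * y).
Proof.
by move=> [u Ou ->] Oy; exists (u * y); rewrite ?mulrA //; exact: integral_mul.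
Qed.

Lemma dvO_mull a x y : O x -> dvO a y -> dvO a (x * y).
Proof. by rewrite mulrC => Ox hy; apply: dvO_mulr. Qed.
Lemma dvO_exp a x n : dvO a x -> dvO (a ^+ n) (x ^+ n).
Proof.
by move=> [u Ou ->]; exists (u ^+ n); [exact: integral_exp | rewrite exprMn].
Qed.

Lemma dvO_expl x m n : O x -> (m <= n)%N -> dvO (x ^+ m) (x ^+ n).
Proof.
by move=> Ox mn; exists (x ^+ (n - m)); [exact: integral_exp | rewrite -exprD subnKC].
Qed.

Lemma dvO_sum a I (r : seq I) (P : pred I) (F : I -> E) :
  (forall i, P i -> dvO a (F i)) -> dvO a (\sum_(i <- r | P i) F i).
Proof. by move=> h; elim/big_ind: _ => //; [exact: dvO0 | exact: dvOD]. Qed.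
Lemma dvO_div a x : a != 0 -> dvO a x <-> O (x / a).
Proof.
move=> a0; split=> [[u Ou ->]|h]; first by rewrite mulrC mulKf.
by exists (x / a); rewrite // mulrC divfK.
Qed.

Lemma small_O x : small x -> O x.
Proof. by move=> sx; have [/dvO1 //|/sx] := dvO_total 1 x. Qed.

Lemma small0 : small 0.
Proof. by case=> u _ /eqP; rewrite mul0r oner_eq0. Qed.

Lemma small_dvO a x : small a -> dvO a x -> small x.
Proof. by move=> sa ax x1; apply: sa; apply: dvO_trans x1. Qed.

Lemma smallD x y : small x -> small y -> small (x + y).
Proof.
move=> sx sy; have [h|h] := dvO_total x y.
  by apply: (small_dvO sx); apply: dvOD => //; apply: dvO_refl.
by apply: (small_dvO sy); apply: dvOD => //; apply: dvO_refl.
Qed.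

Lemma smallN x : small x -> small (- x).
Proof. by move=> sx; apply: (small_dvO sx); apply: dvON; apply: dvO_refl. Qed.

Lemma smallB x y : small x -> small y -> small (x - y).
Proof. by move=> sx sy; apply: smallD => //; apply: smallN. Qed.

Lemma smallMl x y : small x -> O y -> small (x * y).
Proof. by move=> sx Oy; apply: (small_dvO sx); exists y. Qed.

Lemma smallMr x y : O x -> small y -> small (x * y).
Proof. by rewrite mulrC => Ox sy; apply: smallMl. Qed.

Lemma small_sum I (r : seq I) (P : pred I) (F : I -> E) :
  (forall i, P i -> small (F i)) -> small (\sum_(i <- r | P i) F i).
Proof. by move=> h; elim/big_ind: _ => //; [exact: small0 | exact: smallD]. Qed.

Lemma not_small x : ~ small x -> dvO x 1. Proof. exact: contrapT. Qed.

Lemma small_prime x y : small (x * y) -> small x \/ small y.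
Proof.
move=> sxy; apply: contrapT => /not_orP[/not_small x1 /not_small y1].
by apply: sxy; rewrite -[1]mulr1; apply: dvOM.
Qed.

Lemma small_exp_inv x n : small (x ^+ n) -> small x.
Proof.
elim: n => [|n IH]; first by move=> []; rewrite expr0; apply: dvO_refl.
by rewrite exprS => /small_prime[].
Qed.

Lemma small_prod I (r : seq I) (P : pred I) (F : I -> E) :
  small (\prod_(i <- r | P i) F i) -> exists i, P i /\ small (F i).
Proof.
move=> h; apply: contrapT => /forallNP nh; move: h;
  suff: dvO (\prod_(i <- r | P i) F i) 1 by [].
elim/big_ind: _ => [|x y|i Pi]; [exact: dvO_refl | by rewrite -{3}[1]mulr1;
  apply: dvOM |].
by apply: not_small => si; apply: (nh i).
Qed.

Lemma small1_unit x : small (1 - x) -> dvO x 1.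
Proof.
move=> s; apply: not_small => sx; have := smallD s sx; rewrite subrK.
by move/(_ (dvO_refl _)).
Qed.

(** If u = 1/p were a root of a monic R of degree n over Z_p, then multiplying R(u) by p^n would
    give 0 = 1 + p c in Z_p, which fails modulo p. *)
Lemma small_p : small pE.
Proof.
case=> u [R mR Ru] up; have uE : u = pE^-1.
  by apply: (mulfI p_neq0); rewrite -up divff ?p_neq0.
have red (Q : {poly Zp}) n : (size Q <= n.+1)%N ->
    exists c, (map_poly J Q).[u] * pE ^+ n = J (Q`_n + pz * c).
  move=> sQ; exists (\sum_(i < n) Q`_i * pz ^+ (n.-1 - i)).
  rewrite (@horner_coef_wide _ n.+1); last by rewrite (leq_trans (size_poly _ _)).
  rewrite big_ord_recr /= mulrDl -mulrA uE exprVn mulVf ?expf_neq0 ?p_neq0 //.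
  rewrite mulr1 addrC coef_map rmorphD rmorphM rmorph_sum; congr (_ + _).
  rewrite mulr_sumr mulr_suml; apply: eq_bigr => -[i ltin] _ /=.
  have e : pE ^+ n = pE ^+ i * (pE * pE ^+ (n.-1 - i)).
    by rewrite -exprS -exprD; congr (_ ^+ _); lia.
  rewrite coef_map rmorphM rmorphXn !rmorph_nat /= e -mulrA (mulrA (pE^-1 ^+ i))
    -exprMn.
  by rewrite mulVf ?p_neq0 // expr1n mul1r mulrCA.
have [|c] := red R (size R).-1; first by rewrite leqSpred.
move/rootP: Ru => ->; move: mR; rewrite monicE lead_coefE mul0r => /eqP-> /eqP.
rewrite eq_sym J_eq0 => /eqP /(congr1 (fun z : Zp => z 1%N)).
rewrite padic_seqD ((padic_dvdP (pz * c) 1).2 (ex_intro _ c _)) ?expr1 // addr0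
  padic_mod /=.
by rewrite mod0z modz_small // ltz_nat prime_gt1.
Qed.

(** For nonzero [x], let c be the leading coefficient of a polynomial over Z_p killing [x^-1]. Then
    c / x is integral, so [x] cannot be divisible by a higher power of p than c is. *)
Lemma dvO_pX_eq0 x : (forall k, dvO (pE ^+ k) x) -> x = 0.
Proof.
move=> h; apply: contrapT => /eqP x0.
have [P P0] := J_alg x^-1; rewrite rootE => /eqP Px.
have lP : lead_coef P != 0 by rewrite lead_coef_eq0.
set c := lead_coef P in lP.
have Oc : O (J c / x).
  have [n sP] : exists n, size P = n.+1.
    by exists (size P).-1; rewrite prednK // size_poly_gt0.
  pose Q : {poly Zp} := 'X^n + \poly_(i < n) (P`_i * c ^+ (n - i.+1)).
  have sQ : (size (\poly_(i < n) (P`_i * c ^+ (n - i.+1))%R) < n.+1)%N by rewrite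
    ltnS size_poly.
  exists Q; first by rewrite monicE lead_coefDl ?lead_coefXn ?size_polyXn.
  apply/rootP; rewrite rmorphD /= map_polyXn hornerD hornerXn map_poly_poly.
  have [n0|n0] := posnP n.
    move: Px; rewrite (@horner_coef_wide _ 1) ?big_ord1 /=;
      last by rewrite (leq_trans (size_poly _ _)) ?sP ?n0.
    rewrite expr0 mulr1 coef_map /= => /eqP; rewrite J_eq0 => P00.
    by move: lP; rewrite /c lead_coefE sP n0 /= P00.
  rewrite horner_poly; move: Px; rewrite (@horner_coef_wide _ n.+1); last first.
    by rewrite (leq_trans (size_poly _ _)) ?sP.
  move=> /(congr1 (fun z => J c ^+ n.-1 * z));
    rewrite mulr0 big_ord_recr /= addrC mulrDr coef_map /=.
  have -> : P`_n = c by rewrite /c lead_coefE sP.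
  rewrite mulrA -exprSr prednK // -exprMn => Px0; rewrite -[RHS]Px0; congr (_ + _).
  rewrite mulr_sumr; apply: eq_bigr => -[i ltin] _ /=.
  rewrite coef_map rmorphM rmorphXn /= exprMn.
  have -> : n.-1 = (n - i.+1 + i)%N by lia.
  by rewrite exprD; ring.
have [n [u [uU cE]]] := padic_factor lP.
apply: (small_p); have [w Ow xE] := h n.+1.
have Ju0 : J u != 0 by rewrite J_eq0; apply: contraTneq uU => ->; rewrite unitr0.
exists (J u^-1 * (J c / x) * w); first by apply: integral_mul => //;
  apply: integral_mul => //; exact: integral_id.
rewrite cE rmorphM rmorphXn !rmorph_nat /=.
have uu : J u^-1 * J u = 1 by rewrite -rmorphM mulVr ?rmorph1.
have -> : p%:R * (J u^-1 * (p%:R ^+ n * J u / x) * w) = (J u^-1 * J u) * (p%:R ^+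
  n.+1 * w) / x.
  by rewrite exprS; ring.
by rewrite uu mul1r -xE divff.
Qed.

End ValuationRing.

(** * Subfields, minimal polynomials and simple extensions *)

Section SubfieldType.
Variables (E : fieldType) (L : set E) (L_closed : GRing.divring_closed [in L]).

Definition subfield_pred : {pred E} := [in L].
HB.instance Definition _ := GRing.isDivringClosed.Build E subfield_pred L_closed.
Record subfield_carrier := SubfieldCarrier {
  subfield_val : E; subfield_valP : subfield_val \in subfield_pred }.
HB.instance Definition _ := [isSub for subfield_val].
HB.instance Definition _ := [Choice of subfield_carrier by <:].
HB.instance Definition _ := [SubChoice_isSubIntegralDomain of subfield_carrier by <:].
HB.instance Definition _ := [SubIntegralDomain_isSubField of subfield_carrier by <:].

(** Polynomials need a type of coefficients; this turns a subfield given as a set into the image of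
    a field type. *)
Lemma subfield_embedding :
  exists (F : fieldType) (i : {rmorphism F -> E}), range i = L.
Proof.
exists (subfield_carrier : fieldType), (\val : {rmorphism subfield_carrier -> E}).
apply/seteqP; split=> [_ [x _ <-]|x Lx]; first exact/set_mem/(valP x).
by exists (@SubfieldCarrier x (mem_set Lx)).
Qed.
End SubfieldType.

Section MinimalPolynomial.
Variables (F : fieldType) (E : closedFieldType) (i : {rmorphism F -> E}).
Local Notation "Q ^i" := (map_poly i Q) (at level 2, format "Q ^i").
Hypothesis E_char0 : forall n, (0 < n)%N -> (n%:R : E) != 0.
Hypothesis i_alg : forall x, algebraicOver i x.

(** [rs] lists the conjugates of [x]. They stand in for automorphisms: a polynomial relation
    satisfied by [x] over [F] passes to each conjugate because [P] divides it. *)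
Definition is_minpoly (x : E) (P : {poly F}) (rs : seq E) : Prop :=
  [/\ P^i = \prod_(r <- rs) ('X - r%:P), uniq rs, x \in rs &
    forall Q, root Q^i x -> P %| Q].

Lemma minpoly_exists x : exists P rs, is_minpoly x P rs.
Proof.
pose good n := `[< exists P : {poly F}, [/\ P != 0, root P^i x & size P = n] >].
have [|n /asboolP[P0 [P00 P0x sP0]] min_n] := @ex_minnP good.
  by have [P P0 Px] := i_alg x; exists (size P); apply/asboolP; exists P.
pose P : {poly F} := (lead_coef P0)^-1 *: P0.
have lc0 : (lead_coef P0)^-1 != 0 by rewrite invr_eq0 lead_coef_eq0.
have mP : P \is monic by rewrite monicE lead_coefZ mulVf // lead_coef_eq0.
have sP : size P = n by rewrite size_scale.
have Px : root P^i x by rewrite map_polyZ rootZ //= fmorph_eq0.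
have min Q : root Q^i x -> P %| Q.
  move=> Qx; rewrite /dvdp; apply: contraT => r0.
  have : (n <= size (Q %% P)%R)%N.
    apply: min_n; apply/asboolP; exists (Q %% P); split=> //.
    rewrite rootE; move/rootP: Qx; rewrite {1}(divp_eq Q P) rmorphD rmorphM /=
      hornerD hornerM.
    by rewrite (rootP Px) mulr0 add0r => ->.
  by rewrite -sP leqNgt ltn_modp monic_neq0.
have n_gt1 : (1 < n)%N.
  rewrite -sP ltnNge; apply/negP => /size1_polyC PE; move: Px.
  rewrite PE map_polyC rootC fmorph_eq0 => /eqP P00'.
  by move: (monic_neq0 mP); rewrite PE P00' eqxx.
(* Otherwise [P], being minimal, divides its derivative, which has lower degree and is nonzero in
   characteristic 0. *)
have cop : coprimep P P^`().
  rewrite /coprimep; have [h PE] := dvdpP _ _ (dvdp_gcdl P P^`()).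
  have h0 : h != 0 by apply: contraTneq mP => h0;
    rewrite PE h0 mul0r monicE lead_coef0 eq_sym oner_eq0.
  have g0 : gcdp P P^`() != 0 by rewrite gcdp_eq0 (negPf (monic_neq0 mP)).
  move: (Px); rewrite {1}PE rmorphM rootM => /orP[hx|gx].
    have := dvdp_leq h0 (min _ hx); rewrite {1}PE size_mul //.
    by move: h0 g0; rewrite -!size_poly_gt0; lia.
  have dv := dvdp_trans (min _ gx) (dvdp_gcdr P P^`()).
  have P'0 : P^`() != 0.
    apply/eqP => /(congr1 (fun A : {poly F} => A`_n.-2)); rewrite coef_deriv coef0.
    have -> : n.-2.+1 = n.-1 by lia.
    have -> : P`_n.-1 = 1 by move: mP; rewrite monicE lead_coefE sP => /eqP.
    move=> /(congr1 i); rewrite rmorph0 rmorph_nat => /eqP.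
    by rewrite (negPf (E_char0 _)) //; lia.
  by have := dvdp_leq P'0 dv; rewrite leqNgt lt_size_deriv ?monic_neq0.
have [rs rsE] := closed_field_poly_normal P^i.
have lcP : lead_coef P^i = 1 by rewrite lead_coef_map (monicP mP) rmorph1.
rewrite lcP scale1r in rsE.
exists P, rs; split=> //; last by rewrite -root_prod_XsubC -rsE.
by rewrite -separable_prod_XsubC -rsE separable_map unlock.
Qed.

Section Minpoly.
Variables (x : E) (P : {poly F}) (rs : seq E).
Hypothesis minP : is_minpoly x P rs.

Lemma size_minpoly_roots : size P = (size rs).+1.
Proof. by have [PE _ _ _] := minP; rewrite -(size_map_poly i) PE size_prod_XsubC. Qed.

Lemma root_minpoly r : root P^i r = (r \in rs).
Proof. by have [PE _ _ _] := minP; rewrite PE root_prod_XsubC. Qed.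

Lemma minpoly_conj (Q : {poly F}) r : r \in rs -> root Q^i x -> root Q^i r.
Proof.
move=> rrs Qx; have [_ _ _ min] := minP; have /dvdpP[S ->] := min Q Qx.
by rewrite rmorphM rootM root_minpoly rrs orbT.
Qed.

Lemma coprimep_minpoly (Q : {poly F}) : Q^i.[x] != 0 -> coprimep P Q.
Proof.
move=> Qx; have [_ _ xrs min] := minP.
have [h PE] := dvdpP _ _ (dvdp_gcdl P Q).
have P0 : P != 0 by rewrite -size_poly_gt0 size_minpoly_roots.
have h0 : h != 0 by apply: contraNneq P0 => h0; rewrite PE h0 mul0r.
have g0 : gcdp P Q != 0 by rewrite gcdp_eq0 (negPf P0).
have := root_minpoly x; rewrite {1}PE rmorphM rootM xrs /coprimep => /orP[hx|gx].
  have := dvdp_leq h0 (min _ hx); rewrite {1}PE size_mul //.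
  by move: h0 g0; rewrite -!size_poly_gt0; lia.
case/negP: Qx; have /dvdpP[S ->] := dvdp_trans (min _ gx) (dvdp_gcdr P Q).
by rewrite rmorphM -rootE rootM root_minpoly xrs orbT.
Qed.

Lemma minpoly_reduce (Q : {poly F}) : exists2 R : {poly F}, (size R <= size rs)%N &
  forall r, r \in rs -> R^i.[r] = Q^i.[r].
Proof.
have P0 : P != 0 by rewrite -size_poly_gt0 size_minpoly_roots.
exists (Q %% P) => [|r rrs]; first by rewrite -ltnS -size_minpoly_roots ltn_modp.
rewrite [in RHS](divp_eq Q P) rmorphD rmorphM /= hornerD hornerM.
by move: rrs; rewrite -root_minpoly => /rootP->; rewrite mulr0 add0r.
Qed.

(** The remainder of [Q] modulo [P], minus the common value, has degree less than the number of
    conjugates and vanishes at all of them, so it is 0. This is the criterion by which elements are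
    shown to lie in the base field. *)
Lemma minpoly_conj_const (Q : {poly F}) :
  (forall r, r \in rs -> Q^i.[r] = Q^i.[x]) -> range i Q^i.[x].
Proof.
move=> hQ; have [_ Urs xrs _] := minP; have [R sR hR] := minpoly_reduce Q.
suff RE : R^i = (Q^i.[x])%:P.
  by exists R`_0 => //; rewrite -coef_map RE coefC.
apply/eqP; rewrite -subr_eq0; apply/eqP.
apply: (@roots_geq_poly_eq0 _ _ rs) => //.
  by apply/allP => r rrs; rewrite rootE hornerD hornerN hornerC hR // hQ // subrr.
rewrite (leq_trans (size_polyD _ _)) // geq_max size_polyN size_map_poly sR.
by rewrite (leq_trans (size_polyC_leq1 _)) //; case: (rs) xrs.
Qed.

End Minpoly.

Definition simple_ext (x : E) : set E := range (fun Q : {poly F} => Q^i.[x]).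

Lemma simple_ext_id x : simple_ext x x.
Proof. by exists 'X => //; rewrite map_polyX hornerX. Qed.

Lemma range_simple_ext x : range i `<=` simple_ext x.
Proof. by move=> _ [c _ <-]; exists c%:P => //; rewrite map_polyC hornerC. Qed.

Lemma simple_ext_closed x : GRing.divring_closed [in simple_ext x].
Proof.
have [P [rs minP]] := minpoly_exists x; have [_ _ xrs _] := minP.
split=> [|_ _ /set_mem[Q _ <-] /set_mem[R _ <-]|_ _ /set_mem[Q _ <-] /set_mem[R _ <-]].
- by apply/mem_set; exists 1 => //; rewrite rmorph1 hornerC.
- by apply/mem_set; exists (Q - R) => //; rewrite rmorphB hornerD hornerN.
apply/mem_set; have [->|R0] := eqVneq R^i.[x] 0.
  by exists 0 => //; rewrite rmorph0 horner0 invr0 mulr0.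
have /Bezout_eq1_coprimepP[[u v] /= uv] := coprimep_minpoly minP R0.
exists (Q * v) => //; apply: (mulIf R0); rewrite divfK //.
rewrite rmorphM hornerM -mulrA -hornerM -rmorphM.
have -> : v * R = 1 - u * P by rewrite -uv addrC addKr.
rewrite rmorphB rmorphM rmorph1 hornerD hornerN hornerM hornerC.
by move: xrs; rewrite -(root_minpoly minP) => /rootP->; rewrite mulr0 subr0 mulr1.
Qed.

Lemma simple_ext_min x (L : set E) : GRing.divring_closed [in L] -> range i `<=` L ->
  L x -> simple_ext x `<=` L.
Proof.
move=> L_closed iL Lx _ [Q _ <-]; apply: set_mem.
have LB := GRing.divring_closedBM L_closed.
have [L0 LD] : GRing.nmod_closed [in L] := GRing.zmod_closedD (GRing.subring_closedB
  LB).
have [_ LM] : GRing.mulr_closed [in L] := GRing.subring_closedM LB.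
elim/poly_ind: Q => [|Q c IH]; first by rewrite rmorph0 horner0.
rewrite rmorphD rmorphM /= map_polyX map_polyC hornerMXaddC LD ?LM //;
  apply: mem_set => //.
by apply: iL; exists c.
Qed.

Lemma simple_ext_basis x : exists m (b : 'I_m -> E),
  is_basis (range i) (simple_ext x) b.
Proof.
have [P [rs minP]] := minpoly_exists x; have [_ _ xrs min] := minP.
have sP := size_minpoly_roots minP.
exists (size rs), (fun k : 'I_(size rs) => x ^+ k); split=> [k|_ [Q _ <-]].
  by exists 'X^k => //; rewrite map_polyXn hornerXn.
have [R sR hR] := minpoly_reduce minP Q; rewrite -(hR x xrs).
have RE : R^i.[x] = \sum_(k < size rs) i R`_k * x ^+ k.
  rewrite (@horner_coef_wide _ (size rs)) ?size_map_poly //.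
  by apply: eq_bigr => k _; rewrite coef_map.
exists [ffun k : 'I_(size rs) => i R`_k]; split.
  split=> [k|]; first by rewrite ffunE; exists R`_k.
  by rewrite RE; apply: eq_bigr => k _; rewrite ffunE.
move=> a [ha aE]; apply/ffunP => k; rewrite ffunE.
have /choice[c hc] : forall k : 'I_(size rs), exists c, i c = a k.
  by move=> l; have [c _ <-] := ha l; exists c.
pose S := R - \sum_(k < size rs) c k *: 'X^k.
have Sx : root S^i x.
  rewrite rootE rmorphB rmorph_sum hornerD hornerN horner_sum aE subr_eq0 /=.
  apply/eqP/eq_bigr => l _; rewrite -mul_polyC rmorphM /= map_polyC map_polyXn.
  by rewrite hornerM hornerC hornerXn; congr (_ * _); rewrite -hc.
have S0 : S = 0.
  apply/eqP; apply: contraT => S0; have := dvdp_leq S0 (min _ Sx).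
  rewrite sP ltnNge (leq_trans (size_polyD _ _)) // geq_max sR size_polyN.
  apply: (leq_trans (size_sum _ _ _)); apply/bigmax_leqP => l _.
  by rewrite (leq_trans (size_scale_leq _ _)) // size_polyXn.
rewrite -hc; congr (i _); move/eqP: S0; rewrite subr_eq0 => /eqP->.
rewrite coef_sum (bigD1 k) //= coefZ coefXn eqxx mulr1 big1 ?addr0 // => l lk.
by rewrite coefZ coefXn eq_sym [_ == _](negPf lk) mulr0.
Qed.

(** The coordinates of the powers 1, x, ..., x^m form a matrix with more rows than columns; a
    nonzero vector of its left kernel gives the coefficients of [Q]. *)
Lemma basis_annihilator (L : set E) m (b : 'I_m -> E) x :
    GRing.divring_closed [in L] -> L x -> is_basis (range i) L b ->
  exists Q : {poly F}, [/\ Q != 0, (size Q <= m.+1)%N & root Q^i x].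
Proof.
move=> L_closed Lx [_ hb].
have [L1 LM] : GRing.mulr_closed [in L] :=
  GRing.subring_closedM (GRing.divring_closedBM L_closed).
have LX k : L (x ^+ k).
  elim: k => [|k IH]; first by rewrite expr0; apply: set_mem.
  by rewrite exprS; apply: set_mem; apply: LM; apply: mem_set.
have /choice[c hc] : forall k : 'I_m.+1, exists c : 'I_m -> F,
  x ^+ k = \sum_j i (c j) * b j.
  move=> k; have [a [[ha aE] _]] := hb _ (LX k).
  have /choice[c hc] : forall j, exists c, i c = a j.
    by move=> j; have [c _ <-] := ha j; exists c.
  by exists c; rewrite aE; apply: eq_bigr => j _; rewrite hc.
pose C := \matrix_(k < m.+1, j < m) c k j.
have /rowV0Pn[v vC v0] : kermx C != 0.
  rewrite -mxrank_eq0 mxrank_ker subn_eq0 -ltnNge ltnS.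
  exact: rank_leq_col.
exists (rVpoly v); split; last 1 first.
- rewrite rootE /rVpoly map_poly_poly horner_poly; apply/eqP.
  transitivity (\sum_(k < m.+1) \sum_(j < m) i (v 0 k * C k j) * b j).
    apply: eq_bigr => k _; rewrite hc mulr_sumr insubT // => kP.
    by apply: eq_bigr => j _; rewrite mxE rmorphM mulrA; congr (i (v 0 _) * _ * _);
      apply: val_inj.
  rewrite exchange_big big1 // => j _; rewrite -mulr_suml -rmorph_sum.
  have /matrixP/(_ 0 j) := sub_kermxP vC; rewrite !mxE => ->.
  by rewrite rmorph0 mul0r.
- by apply: contraNneq v0 => vE; rewrite -(rVpolyK v) vE linear0.
- exact: size_poly.
Qed.

End MinimalPolynomial.

(** * Residues and roots of unity of order prime to p *)

Section ResidueField.
Variables (p : nat) (p_pr : prime p) (E : closedFieldType).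
Local Notation Zp := (padic_int p_pr).
Variable J : {rmorphism Zp -> E}.
Hypothesis J_inj : injective J.
Hypothesis J_alg : forall x : E, exists2 P : {poly Zp}, P != 0 & root (map_poly J P) x.

Local Notation O := (integralOver J).
Local Notation dvO := (dvO J).
Local Notation small := (small J).
Local Notation pE := (p%:R : E).
Local Notation pz := (p%:R : Zp).

Let small_pE : small pE := small_p J_inj.

(* Pigeonhole: the powers of [y] have finitely many residues modulo [p]. *)
Lemma dvO_p_diff_pow y : O y -> exists a k, (0 < k)%N /\ dvO pE (y ^+ a * (1 - y ^+ k)).
Proof.
case=> R mR Ry.
pose rem k : {poly Zp} := Pdiv.Ring.rmodp 'X^k R.
have p0 := prime_gt0 p_pr.
have rem_lt k c : (absz (((rem k)`_c)%R 1) < p)%N.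
  rewrite -ltz_nat -padic_mod expn1 gez0_abs ?modz_ge0 ?ltz_pmod //.
  by rewrite gt_eqF // ltz_nat.
(* The coefficients modulo p of the remainder of ['X^k] by [R] determine y^k modulo p and take
   finitely many values. *)
pose h (k : nat) : {ffun 'I_(size R) -> 'I_p} := [ffun c : 'I_(size R) =>
  Ordinal (rem_lt k c)].
pose m := #|{ffun 'I_(size R) -> 'I_p}|.
have /injectivePn[a [b ab hab]] : ~~ injectiveb (fun k : 'I_m.+1 => h k).
  by apply/negP => /injectiveP /leq_card; rewrite card_ord ltnn.
have remE k : (map_poly J (rem k)).[y] = y ^+ k.
  have := Pdiv.RingMonic.rdivp_eq mR 'X^k => /(congr1 (fun A => (map_poly J A).[y])).
  rewrite map_polyXn hornerXn rmorphD rmorphM hornerD hornerM.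
  by rewrite (rootP Ry) mulr0 add0r => ->.
wlog lt_ab : a b ab hab / (a < b)%N.
  move=> H; have [|ba|/val_inj] := ltngtP a b; first exact: H.
    by apply: (H b a) => //; rewrite eq_sym.
  by move/eqP; rewrite (negPf ab).
exists a, (b - a)%N; split; first by rewrite subn_gt0.
rewrite mulrBr mulr1 -exprD subnKC ?(ltnW lt_ab) // -!remE.
have [|B [BE _]] := @poly_padic_dvd _ _ (rem a - rem b) 1.
  move=> c; apply/padic_dvdP; rewrite coefB padic_seqB.
  have [cR|Rc] := ltnP c (size R).
    have /(congr1 val) := congr1 (fun g : {ffun 'I_(size R) -> 'I_p} =>
      g (Ordinal cR)) hab.
    rewrite /= !ffunE /= => /(congr1 Posz).
    rewrite !gez0_abs -?[X in 0 <= X]padic_mod ?modz_ge0 ?gt_eqF // ?ltz_nat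
      ?expn_gt0 ?p0 //.
    by move=> ->; rewrite subrr mod0z.
  have s k : (size (rem k) <= c)%N.
    by rewrite (leq_trans _ Rc) // ltnW // Pdiv.Ring.ltn_rmodp monic_neq0.
  by rewrite !nth_default // subrr mod0z.
exists (map_poly J B).[y].
  apply: integral_horner; last by exists R.
  by apply/integral_poly => c; rewrite coef_map; apply: integral_id.
rewrite -hornerN -hornerD -rmorphN -rmorphD BE -mul_polyC rmorphM /= hornerM.
by rewrite map_polyC hornerC /= expr1 rmorph_nat.
Qed.

(** For small [x], the factor 1 - x^k in [dvO_p_diff_pow] is a unit, so p divides a power of [x].
    Smallness, a negative condition, thus becomes a divisibility. *)
Lemma small_pow_p x : small x -> exists k, (0 < k)%N /\ dvO pE (x ^+ k).
Proof.
move=> sx; have Ox := small_O J_inj J_alg sx.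
have [a [k [k0 h]]] := dvO_p_diff_pow Ox.
have sk : small (x ^+ k).
  by rewrite -(prednK k0) exprS; apply: smallMl => //; apply: integral_exp.
have [v Ov uv] : dvO (1 - x ^+ k) 1.
  by apply: (small1_unit J_inj J_alg); rewrite opprB addrC subrK.
have ha : dvO pE (x ^+ a).
  have -> : x ^+ a = x ^+ a * (1 - x ^+ k) * v by rewrite -mulrA -uv mulr1.
  exact: dvO_mulr.
by exists a.+1; split=> //; rewrite exprS; apply: dvO_mull.
Qed.

Lemma not_small1 : ~ small 1.
Proof. by case; apply: dvO_refl. Qed.

Lemma not_small_coprime N : coprime p N -> ~ small N%:R.
Proof.
move=> cop sN; case: (egcdnP N (prime_gt0 p_pr)) => km kn e _.
apply: not_small1.
have e1 : km%:R * p%:R = kn%:R * N%:R + 1 :> E.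
  by rewrite -!natrM e (eqP cop) natrD.
have -> : 1 = km%:R * p%:R - kn%:R * N%:R :> E by rewrite e1; ring.
by apply: (smallB J_inj J_alg); apply: smallMr => //; apply: integral_nat.
Qed.

(** Injectivity of Frobenius on residues: the inner binomial coefficients in (1 + w)^p are multiples
    of p. *)
Lemma small_sub_exp_p z : O z -> small (1 - z ^+ p) -> small (1 - z).
Proof.
move=> Oz s; apply: (@small_exp_inv _ _ _ _ (1 - z) p).
pose w := z - 1; have Ow : O w by apply: integral_sub => //; apply: integral1.
have zE : z = 1 + w by rewrite addrC subrK.
have e : z ^+ p = 1 + w ^+ p + \sum_(1 <= k < p) w ^+ k *+ 'C(p, k).
  rewrite zE exprDn -(big_mkord xpredT (fun k => 1 ^+ (p - k) * w ^+ k *+ 'C(p, k))).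
  rewrite big_ltn // big_nat_recr ?prime_gt0 //= expr0 expr1n mulr1 bin0 mulr1n.
  rewrite subnn expr0 mul1r binn mulr1n -addrA; congr (_ + _); rewrite addrC;
    congr (_ + _).
  by apply: eq_bigr => k _; rewrite expr1n mul1r.
have sS : small (\sum_(1 <= k < p) w ^+ k *+ 'C(p, k)).
  rewrite big_nat_cond; apply: (small_sum J_inj J_alg) => k /andP[/andP[k1 kp] _].
  have /dvdnP[c ->] : (p %| 'C(p, k))%N by apply: prime_dvd_bin; rewrite ?k1.
  rewrite -mulr_natr natrM; apply: smallMr; first exact: integral_exp.
  by apply: smallMr => //; apply: integral_nat.
have sw : small (w ^+ p).
  have -> : w ^+ p = - (1 - z ^+ p) - \sum_(1 <= k < p) w ^+ k *+ 'C(p, k).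
    by rewrite e; ring.
  by apply: (smallB J_inj J_alg) => //; apply: smallN.
have -> : 1 - z = - 1 * w by rewrite /w; ring.
by rewrite exprMn; apply: smallMr => //; apply: integral_exp; apply: integral_opp;
  apply: integral1.
Qed.

(** Teichmueller representatives without completeness: a nonzero residue class has finite order k,
    injectivity of Frobenius removes the p-part of k, and then y^N - 1 is a small product of the y -
    z over the N-th roots of unity z, so that one factor is small. *)
Lemma residue_root_of_unity y : O y -> small y \/
  exists N z, [/\ (0 < N)%N, coprime p N, z ^+ N = 1 & small (y - z)].
Proof.
move=> Oy; have [a [k [k0 h]]] := dvO_p_diff_pow Oy.
have [/small_exp_inv|s] := small_prime (small_dvO small_pE h); first by left.
right; have [N cop kE] := pfactor_coprime p_pr k0.
have N0 : (0 < N)%N by move: k0; rewrite kE; case: N {cop kE}.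
have {}s : small (1 - y ^+ N).
  move: s; rewrite kE exprM; elim: (logn p k) => [|n IH]; first by rewrite expn0 expr1.
  by rewrite expnSr exprM => /small_sub_exp_p s; apply: IH; apply: s;
    apply: integral_exp; apply: integral_exp.
have [rs rsE] := closed_field_poly_normal ('X^N - 1 : {poly E}).
have lc : lead_coef ('X^N - 1 : {poly E}) = 1 by rewrite lead_coefXnsubC.
move: rsE; rewrite lc scale1r => rsE.
have : small (\prod_(z <- rs) (y - z)).
  have := congr1 (fun A => A.[y]) rsE;
    rewrite hornerD hornerN hornerXn hornerC horner_prod.
  under eq_bigr do rewrite hornerXsubC.
  by move=> <-; rewrite -opprB; apply: smallN.
rewrite big_tnth => /small_prod[j [_ sj]]; exists N, (tnth (in_tuple rs) j); split=> //.
have : root ('X^N - 1) (tnth (in_tuple rs) j) by rewrite rsE root_prod_XsubC mem_tnth.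
by rewrite rootE hornerD hornerN hornerXn hornerC subr_eq0 => /eqP.
Qed.

Lemma O_root_of_unity N z : (0 < N)%N -> z ^+ N = 1 -> O z.
Proof.
move=> N0 zN; exists ('X^N - 1); first exact: monicXnsubC.
by rewrite rootE rmorphB rmorph1 /= map_polyXn hornerD hornerN hornerXn hornerC zN
  subrr.
Qed.

(* If [r - r'] is small then so is [N r ^ (N - 1)], which is a unit. *)
Lemma root_of_unity_diff N r r' : (0 < N)%N -> coprime p N ->
  r ^+ N = 1 -> r' ^+ N = 1 -> r != r' -> ~ small (r - r').
Proof.
move=> N0 cop rN r'N rr' s.
have Or := O_root_of_unity N0 rN; have Or' := O_root_of_unity N0 r'N.
have powE k : small (r ^+ k - r' ^+ k).
  by rewrite subrXX; apply: smallMl => //; apply: integral_sum => j _;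
    apply: integral_mul; apply: integral_exp.
have S0 : \sum_(j < N) r ^+ (N.-1 - j) * r' ^+ j = 0.
  have := subrXX r r' N; rewrite rN r'N subrr => /esym/eqP.
  by rewrite mulf_eq0 subr_eq0 (negPf rr') /= => /eqP; case: N {N0 cop rN r'N}.
have : small (N%:R * r' ^+ N.-1).
  have -> : N%:R * r' ^+ N.-1 = \sum_(j < N) - (r ^+ (N.-1 - j) - r' ^+ (N.-1 - j)) *
    r' ^+ j.
    under eq_bigr do rewrite mulNr mulrBl opprB.
    rewrite sumrB S0 subr0 (eq_bigr (fun=> r' ^+ N.-1)).
      by rewrite sumr_const card_ord mulr_natl.
    by move=> [j ltj] _; rewrite -exprD subnK //=; move: ltj N0; clear; lia.
  apply: (small_sum J_inj J_alg) => j _; apply: smallMl; last exact: integral_exp.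
  exact: smallN.
move=> /small_prime[|/small_exp_inv sr']; first exact: not_small_coprime.
apply: not_small1; rewrite -r'N -(prednK N0) exprS; apply: smallMl => //.
exact: integral_exp.
Qed.

(* Newton interpolation. *)
Lemma small_interpolation (rs : seq E) (A : {poly E}) :
    uniq rs -> (forall r, r \in rs -> O r) ->
    (forall r r', r \in rs -> r' \in rs -> r != r' -> ~ small (r - r')) ->
    (size A <= size rs)%N -> (forall r, r \in rs -> small A.[r]) ->
  forall k, small A`_k.
Proof.
elim: rs A => [|r rs IH] A /=.
  by rewrite leqn0 size_poly_eq0 => _ _ _ /eqP-> _ k; rewrite coef0; apply: small0.
move=> /andP[nr Urs] Ors dif sA hA.
have Or : O r by apply: Ors; rewrite mem_head.
have sAr : small A.[r] by apply: hA; rewrite mem_head.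
have : root (A - A.[r]%:P) r by rewrite rootE hornerD hornerN hornerC subrr.
move=> /factor_theorem[B BE].
have AE : A = B * ('X - r%:P) + A.[r]%:P by rewrite -BE subrK.
(* At another node s, the value of [B] is (A(s) - A(r)) / (s - r), where the numerator is small and
   the denominator is a unit. *)
have hB k : small B`_k.
  apply: IH => // [s srs|s s' srs s'rs| |s srs].
  - by apply: Ors; rewrite inE srs orbT.
  - by apply: dif; rewrite inE ?srs ?s'rs orbT.
  - have [->|B0] := eqVneq B 0; first by rewrite size_poly0.
    have sX : size (B * ('X - r%:P)) = (size B).+1.
      by rewrite size_Mmonic ?monicXsubC // size_XsubC addn2.
    rewrite -ltnS (leq_trans _ sA) // AE size_polyDl sX // ltnS (leq_trans
      (size_polyC_leq1 _)) //.
    by rewrite size_poly_gt0.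
  have := congr1 (fun A => A.[s]) BE.
  rewrite hornerD hornerN hornerC hornerM hornerXsubC => e.
  have : small (B.[s] * (s - r)).
    by rewrite -e; apply: (smallB J_inj J_alg) => //; apply: hA; rewrite inE srs orbT.
  case/small_prime => // ssr; exfalso; apply: (dif s r) => //;
    rewrite ?inE ?eqxx ?srs ?orbT //.
  by apply: contraNneq nr => <-.
move=> k; rewrite AE coefD mulrBr coefB coefMX coefMC coefC.
apply: (smallD J_inj J_alg); last by case: ifP => // _; apply: small0.
apply: (smallB J_inj J_alg); last by apply: smallMl.
by case: ifP => // _; apply: small0.
Qed.

End ResidueField.

(** * Conjugates and unramified extensions *)

Lemma lift_poly (R R' : nzRingType) (E : nzRingType) (j : {rmorphism R -> E})
    (i : {rmorphism R' -> E}) : range j `<=` range i ->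
  forall P : {poly R}, exists S : {poly R'}, map_poly i S = map_poly j P.
Proof.
move=> ji P; have /choice[c hc] : forall z, exists c, i c = j z.
  by move=> z; have [|c _ <-] := ji (j z); [exists z | exists c].
exists (\poly_(k < size P) c P`_k); apply/polyP => k.
rewrite !coef_map coef_poly /=; case: ltnP => [_|h]; first exact: hc.
by rewrite rmorph0 nth_default ?rmorph0.
Qed.

Section Conjugates.
Variables (p : nat) (p_pr : prime p) (E : closedFieldType).
Local Notation Zp := (padic_int p_pr).
Variable J : {rmorphism Zp -> E}.
Hypothesis J_inj : injective J.
Hypothesis J_alg : forall x : E, exists2 P : {poly Zp}, P != 0 & root (map_poly J P) x.

Local Notation O := (integralOver J).
Local Notation dvO := (dvO J).
Local Notation small := (small J).
Local Notation pE := (p%:R : E).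

Lemma dvO_smallX_eq0 a x : small a -> (forall k, dvO (a ^+ k) x) -> x = 0.
Proof.
move=> /(small_pow_p J_inj J_alg)[j [_ aj]] h; apply: (dvO_pX_eq0 J_inj J_alg) => k.
by apply: dvO_trans (h (j * k)%N); rewrite exprM; apply: dvO_exp.
Qed.

Section Base.
Variables (F : fieldType) (i : {rmorphism F -> E}).
Local Notation "Q ^i" := (map_poly i Q) (at level 2, format "Q ^i").
Hypothesis iJ : forall z, range i (J z).

Lemma lift_padic_poly (P : {poly Zp}) : exists S : {poly F}, S^i = map_poly J P.
Proof.
by apply: lift_poly P => _ [z _ <-].
Qed.

Lemma algebraic_base x : algebraicOver i x.
Proof.
have [P P0 Px] := J_alg x; have [S SE] := lift_padic_poly P.
exists S; last by rewrite SE.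
by rewrite -(map_poly_eq0 i) SE -size_poly_eq0 size_map_inj_poly ?rmorph0
  ?size_poly_eq0.
Qed.

Let char0 := natr_neq0 J_inj.

Section ConjIntegral.
Variables (x : E) (P : {poly F}) (rs : seq E).
Hypothesis minP : is_minpoly i x P rs.

(** If R is a monic equation of Q(x) over Z_p, then R o Q has coefficients in [F] and vanishes at
    [x], hence at its conjugates. *)
Lemma conj_O (Q : {poly F}) r : r \in rs -> O Q^i.[x] -> O Q^i.[r].
Proof.
move=> rrs [R mR RQ]; have [S SE] := lift_padic_poly R; exists R => //.
rewrite -SE rootE -horner_comp -map_comp_poly -rootE.
by apply: (minpoly_conj minP rrs); rewrite rootE map_comp_poly horner_comp SE.
Qed.

Lemma conj_dvO c (Q : {poly F}) r : r \in rs -> dvO (i c) Q^i.[x] -> dvO (i c) Q^i.[r].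
Proof.
move=> rrs; have [->|c0] := eqVneq c 0.
  rewrite rmorph0 => -[u _]; rewrite mul0r => /eqP; rewrite -rootE => Qx.
  by rewrite (rootP (minpoly_conj minP rrs Qx)); apply: dvO0.
have ic0 : i c != 0 by rewrite fmorph_eq0.
have e s : (c^-1 *: Q)^i.[s] = Q^i.[s] / i c.
  by rewrite map_polyZ hornerZ /= fmorphV mulrC.
by move=> /(dvO_div _ _ ic0) h; apply/(dvO_div _ _ ic0); rewrite -e; apply: conj_O;
  rewrite ?e.
Qed.

(** By [small_pow_p] smallness is a divisibility by p, an element of [F], and [conj_dvO] transports
    it. *)
Lemma conj_small (Q : {poly F}) r : r \in rs -> small Q^i.[x] -> small Q^i.[r].
Proof.
move=> rrs /(small_pow_p J_inj J_alg)[k [_]];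
  rewrite -(rmorph_nat i) -horner_exp -rmorphXn.
move/(conj_dvO rrs); rewrite rmorphXn horner_exp rmorph_nat => h.
exact: small_exp_inv (small_dvO (small_p J_inj) h).
Qed.

End ConjIntegral.

Lemma dvO_least n (a : nat -> E) : exists2 k, (k <= n)%N & forall l,
  (l <= n)%N -> dvO (a k) (a l).
Proof.
elim: n => [|n [k kn IH]]; first by exists 0%N => // l; rewrite leqn0 => /eqP->;
  apply: dvO_refl.
have [h|h] := dvO_total J_inj J_alg (a k) (a n.+1).
  exists k => [|l]; first exact: leqW.
  by rewrite leq_eqVlt => /orP[/eqP->//|]; rewrite ltnS; apply: IH.
exists n.+1 => // l; rewrite leq_eqVlt => /orP[/eqP->|]; first exact: dvO_refl.
by rewrite ltnS => /IH; apply: dvO_trans.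
Qed.

(** [a] plays the role of a uniformizer of [F]: it will be p for Q_p, and a uniformizer of K for K
    and its unramified extensions. *)
Variable a : E.
Hypothesis small_base : forall c, small (i c) -> dvO a (i c).

(* Scale [Q] so that its coefficients are integral and some are units; at the
   lowest unit coefficient, of index [k], the terms of index at least [k] sum to
   [x ^ k] times a unit, and the lower ones are divisible by [a]. *)
Lemma dvO_pow_of_root (Q : {poly F}) B x : Q != 0 -> (size Q <= B.+1)%N ->
  root Q^i x -> small x -> dvO a (x ^+ B).
Proof.
move=> Q0 sQ Qx sx; have Ox := small_O J_inj J_alg sx.
have [l _ hl] := dvO_least (size Q) (fun k => i Q`_k).
have Ql0 : Q`_l != 0.
  apply: contraNneq Q0 => Ql; rewrite -lead_coef_eq0 lead_coefE -(fmorph_eq0 i).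
  have [|u _ ->] := hl (size Q).-1; first exact: leq_pred.
  by rewrite Ql rmorph0 mul0r.
pose A : {poly F} := (Q`_l)^-1 *: Q.
have iQl : i Q`_l != 0 by rewrite fmorph_eq0.
have OA k : O (i A`_k).
  rewrite coefZ rmorphM fmorphV mulrC; apply/dvO_div => //.
  have [kQ|Qk] := leqP k (size Q); first exact: hl.
  by rewrite [Q`_k]nth_default ?rmorph0; [apply: dvO0 | apply: ltnW].
have OAx (n : nat) : O (drop_poly n A)^i.[x].
  apply: integral_horner => //; apply/integral_poly => k.
  by rewrite coef_map coef_drop_poly; apply: OA.
have ex : exists k, `[< ~ small (i A`_k) >].
  by exists l; apply/asboolP; rewrite coefZ mulVf // rmorph1; apply: not_small1.
case: (ex_minnP ex) => k /asboolP nk min_k.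
have kB : (k <= B)%N.
  rewrite -ltnS (leq_trans _ sQ) // ltnNge; apply/negP => h; apply: nk.
  by rewrite coefZ [Q`_k]nth_default // mulr0 rmorph0; apply: small0.
apply: (@dvO_trans _ _ _ _ (x ^+ k)); last exact: dvO_expl.
have Ax : (take_poly k A)^i.[x] + (drop_poly k A)^i.[x] * x ^+ k = 0.
  rewrite -[x ^+ k]hornerXn -(map_polyXn i) -hornerM -rmorphM -hornerD -rmorphD.
  by rewrite poly_take_drop /= map_polyZ /= hornerZ (rootP Qx) mulr0.
have [v Ov uv] : dvO (drop_poly k A)^i.[x] 1.
  apply: not_small => s; apply: nk.
  have e : (drop_poly k A)^i.[x] = i A`_k + (drop_poly k.+1 A)^i.[x] * x.
    have -> : drop_poly k A = drop_poly k.+1 A * 'X + (A`_k)%:P.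
      apply/polyP => -[|j]; rewrite coefD coefC coefMX !coef_drop_poly /= ?add0r //.
      by rewrite addr0 addnS addSn.
    by rewrite rmorphD rmorphM /= map_polyC map_polyX hornerMXaddC addrC.
  have -> : i A`_k = (drop_poly k A)^i.[x] - (drop_poly k.+1 A)^i.[x] * x by rewrite
    e addrK.
  by apply: (smallB J_inj J_alg) => //; apply: smallMr.
have -> : x ^+ k = - (take_poly k A)^i.[x] * v.
  by move/eqP: Ax; rewrite addr_eq0 => /eqP->; rewrite opprK mulrAC -uv mul1r.
apply: dvO_mulr => //; apply: dvON.
rewrite (@horner_coef_wide _ k); last by rewrite size_map_poly size_take_poly.
apply: dvO_sum => j _; apply: dvO_mulr; last exact: integral_exp.
rewrite coef_map coef_take_poly ltn_ord; apply: small_base; apply: contrapT => nj.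
by have := min_k j (asboolT nj); rewrite leqNgt ltn_ord.
Qed.

(* Write [y = R(z)] with [R] of degree less than that of [z]. Its values at the
   conjugates of [z] are small, hence so are its coefficients, by interpolation. *)
Lemma small_simple_ext_root_of_unity N z y : (0 < N)%N -> coprime p N -> z ^+ N = 1 ->
  simple_ext i z y -> small y -> dvO a y.
Proof.
move=> N0 cop zN [Q _ <-] sy.
have [P [rs minP]] := minpoly_exists char0 algebraic_base z.
have [_ Urs zrs min] := minP.
have rsN r : r \in rs -> r ^+ N = 1.
  move=> rrs; have : root ('X^N - 1)^i r.
    apply: (minpoly_conj minP rrs).
    by rewrite rootE rmorphB rmorph1 /= map_polyXn hornerD hornerN hornerXn hornerC
      zN subrr.
  by rewrite rootE rmorphB rmorph1 /= map_polyXn hornerD hornerN hornerXn hornerC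
    subr_eq0 => /eqP.
have [R sR hR] := minpoly_reduce minP Q.
have sRk : forall k, small R^i`_k.
  apply: (small_interpolation J_inj J_alg Urs) => [r rrs|r r' rrs r'rs||r rrs].
  - exact: O_root_of_unity (rsN r rrs).
  - by apply: root_of_unity_diff N0 cop _ _ => //; apply: rsN.
  - by rewrite size_map_poly.
  - by rewrite hR //; apply: (conj_small minP).
rewrite -(hR z zrs) horner_coef; apply: dvO_sum => k _; apply: dvO_mulr.
  by have := sRk k; rewrite coef_map; apply: small_base.
by apply: integral_exp; apply: O_root_of_unity zN.
Qed.

(* The extension generated by all roots of unity of order prime to [p]; finitely
   many of them are powers of a single one. *)
Definition unity_ext : set E := [set y | exists N z,
  [/\ (0 < N)%N, coprime p N, z ^+ N = 1 & simple_ext i z y]].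

Lemma small_unity_ext y : unity_ext y -> small y -> dvO a y.
Proof.
by move=> [N [z [N0 cop zN zy]]]; exact: (small_simple_ext_root_of_unity N0 cop zN zy).
Qed.

Lemma range_unity_ext : range i `<=` unity_ext.
Proof.
move=> y iy; exists 1%N, 1; split; rewrite ?coprimen1 ?expr1n //.
exact: range_simple_ext iy.
Qed.

Lemma root_of_unity_ext N z : (0 < N)%N -> coprime p N -> z ^+ N = 1 -> unity_ext z.
Proof. by move=> N0 cop zN; exists N, z; split=> //; apply: simple_ext_id. Qed.

Lemma prim_root_exists N : (0 < N)%N -> exists w : E, N.-primitive_root w.
Proof.
move=> N0; have [rs rsE] := closed_field_poly_normal ('X^N - 1 : {poly E}).
move: rsE; rewrite lead_coefXnsubC // scale1r => rsE.
have Urs : uniq rs by rewrite -separable_prod_XsubC -rsE separable_Xn_sub_1 ?char0.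
have : has N.-primitive_root rs.
  apply: cyclic.has_prim_root => //.
    apply/allP => z; rewrite -root_prod_XsubC -rsE /= unity_rootE rootE.
    by rewrite hornerD hornerN hornerXn hornerC subr_eq0.
  by have := size_XnsubC (1 : E) N0; rewrite rsE size_prod_XsubC => -[->].
by case/hasP => w _ wN; exists w.
Qed.

Lemma unity_ext_join y1 y2 : unity_ext y1 -> unity_ext y2 -> exists N z,
  [/\ (0 < N)%N, coprime p N, z ^+ N = 1, simple_ext i z y1 & simple_ext i z y2].
Proof.
move=> [N1 [z1 [N10 cop1 z1N zy1]]] [N2 [z2 [N20 cop2 z2N zy2]]].
have N0 : (0 < N1 * N2)%N by rewrite muln_gt0 N10.
have [w wN] := prim_root_exists N0.
have gw M z y : z ^+ M = 1 -> (M %| N1 * N2)%N -> simple_ext i z y -> simple_ext i w y.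
  move=> zM /dvdnP[c cE] zy.
  have [|k zE] := @prim_rootP _ _ _ wN z; first by rewrite cE mulnC exprM zM expr1n.
  apply: (@simple_ext_min _ _ i z) zy;
    [exact: simple_ext_closed char0 algebraic_base _ | exact: range_simple_ext |].
  by rewrite zE; exists 'X^k => //; rewrite map_polyXn hornerXn.
exists (N1 * N2)%N, w; split=> //; first by rewrite coprimeMr cop1.
- exact: prim_expr_order.
- by apply: gw z1N _ zy1; apply: dvdn_mulr.
- by apply: gw z2N _ zy2; apply: dvdn_mull.
Qed.

Lemma unity_ext_closed : GRing.divring_closed [in unity_ext].
Proof.
split=> [|y1 y2 /set_mem h1 /set_mem h2|y1 y2 /set_mem h1 /set_mem h2].
- by apply/mem_set/range_unity_ext; exists 1; rewrite ?rmorph1.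
- have [N [z [N0 cop zN zy1 zy2]]] := unity_ext_join h1 h2.
  have [_ gB _] := simple_ext_closed char0 algebraic_base z.
  by apply/mem_set; exists N, z; split=> //; apply: set_mem; apply: gB; apply: mem_set.
- have [N [z [N0 cop zN zy1 zy2]]] := unity_ext_join h1 h2.
  have [_ _ gV] := simple_ext_closed char0 algebraic_base z.
  by apply/mem_set; exists N, z; split=> //; apply: set_mem; apply: gV; apply: mem_set.
Qed.

End Base.

Lemma unity_ext_sub (F F' : fieldType) (i : {rmorphism F -> E}) (i' :
  {rmorphism F' -> E}) :
    (forall z, range i (J z)) -> range i `<=` range i' -> unity_ext i `<=` unity_ext i'.
Proof.
move=> iJ ii' y [N [z [N0 cop zN zy]]]; exists N, z; split=> //.
have i'J c : range i' (J c) by apply: ii'.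
apply: (@simple_ext_min _ _ i z) zy; [| |exact: simple_ext_id].
  by apply: simple_ext_closed; [exact: natr_neq0 J_inj | exact: algebraic_base].
by apply: subset_trans ii' _; apply: range_simple_ext.
Qed.

(* An integral [x] in [L] is congruent to some [a] in [unity_ext i] modulo any
   power of [c]; any conjugate of [x] over [unity_ext i] is congruent to the same
   [a], hence equal to [x]. *)
Lemma unramified_sub_unity_ext (F : fieldType) (i : {rmorphism F -> E})
    (c : F) (L : set E) :
    (forall z, range i (J z)) -> c != 0 -> small (i c) ->
    GRing.divring_closed [in L] -> range i `<=` L ->
    (forall x, L x -> small x -> dvO (i c) x) ->
  L `<=` unity_ext i.
Proof.
move=> iJ c0 sc L_closed iL small_L.
have ic0 : i c != 0 by rewrite fmorph_eq0.
have [F1 [i1 i1E]] := subfield_embedding L_closed.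
have [F2 [i2 i2E]] := subfield_embedding (unity_ext_closed iJ).
have i1J z : range i1 (J z) by rewrite i1E; apply: iL.
have i2J z : range i2 (J z) by rewrite i2E; apply: range_unity_ext.
(* [M] is [L] with the roots of unity of order prime to p adjoined: it contains both [x] and its
   approximations, and small elements of [M] are still divisible by [c]. *)
pose M := unity_ext i1.
have [_ MB MV] : GRing.divring_closed [in M] := unity_ext_closed i1J.
have iM : unity_ext i `<=` M by apply: unity_ext_sub => //; rewrite i1E.
have small_M y : M y -> small y -> dvO (i c) y.
  apply: small_unity_ext => // d; apply: small_L.
  by rewrite -i1E; exists d.
have [_ _ FV] := unity_ext_closed iJ.
have [_ FM] : GRing.mulr_closed [in unity_ext i] :=
  GRing.subring_closedM (GRing.divring_closedBM (unity_ext_closed iJ)).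
have [_ FD] : GRing.nmod_closed [in unity_ext i] :=
  GRing.zmod_closedD (GRing.subring_closedB (GRing.divring_closedBM (unity_ext_closed
    iJ))).
have Fc k : unity_ext i (i c ^+ k) by apply: range_unity_ext; exists (c ^+ k);
  rewrite ?rmorphXn.
(* Expansion in powers of [c] with digits 0 or roots of unity: subtracting the digit d from the
   remainder b leaves a small element of [M], and its quotient by [c] is the next remainder. *)
have approx x k : M x -> O x -> exists a b, [/\ unity_ext i a, M b,
  O b & x = a + i c ^+ k * b].
  move=> Mx Ox; elim: k => [|k [a [b [Fa Mb Ob xE]]]].
    exists 0, x; split=> //; last by rewrite expr0 mul1r add0r.
    by apply: range_unity_ext; exists 0; rewrite ?rmorph0.
  have [d Fd sbd] : exists2 d, unity_ext i d & small (b - d).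
    have [sb|[N [z [N0 cop zN s]]]] := residue_root_of_unity J_inj J_alg Ob.
      by exists 0; rewrite ?subr0 //; apply: range_unity_ext; exists 0;
        rewrite ?rmorph0.
    by exists z => //; apply: root_of_unity_ext zN.
  have Mbd : M (b - d) by apply: set_mem; apply: MB; apply: mem_set => //; apply: iM.
  have Obd := (dvO_div J _ ic0).1 (small_M _ Mbd sbd).
  exists (a + i c ^+ k * d), ((b - d) / i c); split=> //.
  - apply: set_mem; apply: FD; first exact: mem_set.
    by apply: FM; apply: mem_set.
  - apply: set_mem; apply: MV; apply: mem_set => //.
    by apply: iM; apply: range_unity_ext; exists c.
  - by rewrite xE exprSr; field.
have O_case x : L x -> O x -> unity_ext i x.
  move=> Lx Ox; have Mx : M x by apply: range_unity_ext; rewrite i1E.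
  have [P [rs minP]] := minpoly_exists (natr_neq0 J_inj) (algebraic_base i2J) x.
  have [_ _ xrs _] := minP.
  rewrite -i2E -[x]hornerX -(map_polyX i2); apply: (minpoly_conj_const minP) => r rrs.
  rewrite map_polyX !hornerX; apply/eqP; rewrite -subr_eq0; apply/eqP.
  apply: (dvO_smallX_eq0 sc) => k; have [a [b [Fa Mb Ob xE]]] := approx x k Mx Ox.
  have [a' _ a'E] : range i2 a by rewrite i2E.
  have [c' _ c'E] : range i2 (i c ^+ k) by rewrite i2E.
  have hX s : (map_poly i2 ('X - (a')%:P)).[s] = s - a.
    by rewrite rmorphB /= map_polyX map_polyC hornerXsubC /= a'E.
  have -> : r - x = (r - a) - i c ^+ k * b by rewrite xE; ring.
  apply: dvOB; last by exists b.
  rewrite -hX // -c'E; apply: (conj_dvO i2J minP rrs); rewrite hX // c'E xE.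
  by exists b => //; rewrite addrC addKr.
move=> x Lx; have [Ox|Ox] := O_valuation J_inj J_alg x; first exact: O_case.
rewrite -[x]invrK -[_^-1]mul1r; apply: set_mem; apply: FV; apply: mem_set.
  by apply: range_unity_ext; exists 1; rewrite ?rmorph1.
apply: O_case => //; have [L1 _ LV] := L_closed.
by rewrite -[_^-1]mul1r; apply: set_mem; apply: LV => //; apply: mem_set.
Qed.

End Conjugates.

(** * Uniformizers of finite extensions of Q_p *)

Section Fractions.
Import FracField.
Local Open Scope quotient_scope.

Lemma fraction_numden (R : idomainType) (x : {fraction R}) :
  exists a b, b != 0 /\ x = tofrac a / tofrac b.
Proof.
elim/quotW: x => x; have dx := denom_ratioP x; exists (frac x).1, (frac x).2.
have tx : tofrac (frac x).2 != 0 by rewrite -tofrac0 tofrac_eq.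
split=> //; apply: (mulIf tx); rewrite divfK //; unlock tofrac.
rewrite -[LHS]pi_mul; apply/eqmodP; rewrite /= equivfE /mulf.
by rewrite !numden_Ratio ?mulf_neq0 ?oner_eq0 ?numden_Ratio // ?mulr1 mulrC.
Qed.
End Fractions.

Section LocalField.
Variables (p : nat) (p_pr : prime p) (K : fieldExtType (padic p_pr)).
Variables (Kbar : closedFieldType) (iota : {rmorphism K -> Kbar}).
Hypothesis Kbar_algebraic : forall x : Kbar, algebraicOver iota x.
Local Notation Zp := (padic_int p_pr).
Local Notation Qp := (padic p_pr).

Let J : {rmorphism Zp -> Kbar} := closure_emb iota.
Let e : {rmorphism Qp -> Kbar} := iota \o in_alg K.
Local Notation O := (integralOver J).
Local Notation dvO := (dvO J).
Local Notation small := (small J).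
Local Notation pE := (p%:R : Kbar).

Lemma closure_embE z : J z = e (padic_emb p_pr z). Proof. by []. Qed.

Lemma padic_emb_inj : injective (padic_emb p_pr).
Proof. by move=> x y /eqP; rewrite tofrac_eq => /eqP. Qed.

Lemma closure_emb_inj : injective J.
Proof. by move=> x y; rewrite !closure_embE => /fmorph_inj /padic_emb_inj. Qed.

Lemma padic_fraction (c : Qp) : exists a b,
  b != 0 /\ c = padic_emb p_pr a / padic_emb p_pr b.
Proof. exact: fraction_numden. Qed.

Lemma padic_emb_eq0 z : (padic_emb p_pr z == 0) = (z == 0).
Proof. by rewrite -(rmorph0 (padic_emb p_pr)) (inj_eq padic_emb_inj). Qed.

Lemma padic_common_denominator (Q : {poly Qp}) : exists (b : Zp) (P : {poly Zp}),
  b != 0 /\ padic_emb p_pr b *: Q = map_poly (padic_emb p_pr) P.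
Proof.
elim/poly_ind: Q => [|Q c [b [P [b0 PE]]]].
  by exists 1, 0; rewrite oner_neq0 scaler0 rmorph0.
have [a [d [d0 ->]]] := padic_fraction c.
exists (b * d), (d *: P * 'X + (b * a)%:P); split; first by rewrite mulf_neq0.
rewrite [RHS]rmorphD [X in _ = X + _]rmorphM /= map_polyX map_polyC map_polyZ -PE /=
  scalerDr scalerAl.
rewrite scalerA -rmorphM (mulrC d b); congr (_ + _).
have ed : padic_emb p_pr d != 0 by rewrite padic_emb_eq0.
have mulE x y z : y != 0 -> x * y * (z / y) = x * z :> Qp.
  by move=> y0; rewrite mulrA mulrAC mulfK.
by rewrite -mul_polyC -polyCM !(rmorphM (padic_emb p_pr)) mulE.
Qed.

(** The degree bound will limit the number of nonunit factors of p in K. *)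
Lemma K_annihilator (a : K) : exists Q : {poly Qp},
  [/\ Q != 0, (size Q <= (\dim {:K}).+1)%N & root (map_poly e Q) (iota a)].
Proof.
have /polyOver1P[Q QE] := minPolyOver 1%AS a.
have Q0 : Q != 0.
  by rewrite -(map_poly_eq0 (in_alg K)) -QE monic_neq0 ?monic_minPoly.
exists Q; split=> //.
  rewrite -(size_map_poly (in_alg K)) -QE size_minPoly ltnS.
  by have := dim_Fadjoin 1%AS a; rewrite dimv1 muln1 => <-; apply/dimvS/subvf.
by rewrite /e map_poly_comp -QE rmorph_root ?root_minPoly.
Qed.

Lemma closure_emb_alg x : exists2 P : {poly Zp}, P != 0 & root (map_poly J P) x.
Proof.
have [R R0 Rx] := Kbar_algebraic x.
have [Q Q0 Qx] : algebraicOver e x.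
  apply/integral_algebraic/(integral_root _ Rx); first by rewrite map_poly_eq0.
  apply/integral_poly => k; rewrite coef_map /=; apply/integral_algebraic.
  by have [Q [Q0 _ Qk]] := K_annihilator R`_k; exists Q.
have [b [P [b0 PE]]] := padic_common_denominator Q.
have eb : padic_emb p_pr b != 0 by rewrite padic_emb_eq0.
exists P.
  apply: contraNneq Q0 => P0; move/eqP: PE; rewrite P0 rmorph0 scaler_eq0 (negPf eb).
  by [].
have -> : map_poly J P = map_poly e (map_poly (padic_emb p_pr) P).
  by rewrite -map_poly_comp.
by rewrite -PE map_polyZ rootZ ?fmorph_eq0.
Qed.

Let J_inj := closure_emb_inj.
Let J_alg := closure_emb_alg.

Lemma small_padic (c : Qp) : small (e c) -> dvO pE (e c).
Proof.
have [a [b [b0 ->]]] := padic_fraction c.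
have [->|a0] := eqVneq a 0; first by rewrite rmorph0 mul0r rmorph0 => _; apply: dvO0.
have [m [u [uU ->]]] := padic_factor a0; have [n [v [vU ->]]] := padic_factor b0.
rewrite fmorph_div -!closure_embE !rmorphM !rmorphXn !rmorph_nat.
have unit w : w \is a GRing.unit -> J w * J w^-1 = 1 by move=> wU;
  rewrite -rmorphM mulrV ?rmorph1.
have J0 w : w \is a GRing.unit -> J w != 0.
  move=> wU; apply/eqP => w0; have := unit w wU.
  by rewrite w0 mul0r => /esym/eqP; rewrite oner_eq0.
have pX k : pE ^+ k != 0 by rewrite expf_neq0 ?(p_neq0 J_inj).
have [nm|mn] := ltnP n m; move=> s.
  exists (pE ^+ (m - n).-1 * J u * J v^-1).
    by apply: integral_mul; [apply: integral_mul;
      [apply/integral_exp/integral_nat|]|]; apply: integral_id.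
  apply: (mulIf (mulf_neq0 (pX n) (J0 v vU))); rewrite divfK ?mulf_neq0 ?J0 //.
  have -> : m = (n + (m - n).-1.+1)%N by rewrite prednK ?subn_gt0 // subnKC // ltnW.
  rewrite exprD exprS -[LHS]mulr1 -(unit v vU).
  set k := (_ - _)%N; have -> : ((n + k.-1.+1 - n).-1 = k.-1)%N by lia.
  ring.
case: s; exists (pE ^+ (n - m) * J v * J u^-1).
  by apply: integral_mul; [apply: integral_mul; [apply/integral_exp/integral_nat|]|];
    apply: integral_id.
rewrite -[in X in _ / (X * _)](subnKC mn) exprD.
have h1 := unit u uU; have h2 := J0 v vU; have h3 := pX m; have h4 := pX (n - m)%N.
rewrite -[LHS]h1; field; do ?[apply/andP; split]; rewrite // ?h2.
Qed.

(* Any factor in a factorization of [p] into the largest number of nonunits. *)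
Lemma uniformizer_exists : exists c : K, [/\ c != 0, small (iota c) &
  forall d, small (iota d) -> dvO (iota c) (iota d)].
Proof.
pose M := \dim {:K}.
have powM d : small (iota d) -> dvO pE (iota d ^+ M).
  have [Q [Q0 sQ Qd]] := K_annihilator d.
  by apply: (dvO_pow_of_root J_inj J_alg small_padic Q0 sQ Qd).
pose good k := `[< exists s : seq K, [/\ size s = k, (forall z,
  z \in s -> small (iota z)) &
  \prod_(z <- s) z = p%:R] >].
have sp := small_p J_inj.
(* Each factor z satisfies p | z^M, so a product p of k nonunits gives p^k | p^M. *)
have bnd k : good k -> (k <= M)%N.
  move=> /asboolP[s [<- hs sE]]; rewrite leqNgt; apply/negP => lt.
  have : dvO (pE ^+ size s) (pE ^+ M).
    have e1 : pE = \prod_(z <- s) iota z by rewrite -(rmorph_nat iota) -sE rmorph_prod.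
    rewrite [X in dvO _ (X ^+ M)]e1 -prodrXl.
    elim: s {sE lt e1} hs => [|z s IH] hs; first by rewrite big_nil expr0;
      apply: dvO_refl.
    rewrite big_cons exprS; apply: dvOM; first by apply: powM; apply: hs;
      rewrite mem_head.
    by apply: IH => y ys; apply: hs; rewrite inE ys orbT.
  rewrite -(subnKC lt) addSnnS exprD => -[u Ou]; rewrite -[LHS]mulr1 -mulrA.
  move/(mulfI (expf_neq0 _ (p_neq0 J_inj))) => u1.
  apply: sp; exists (pE ^+ (size s - M.+1) * u); last by rewrite mulrA -exprS.
  by apply: integral_mul => //; apply: integral_exp; apply: integral_nat.
have good1 : good 1.
  apply/asboolP; exists [:: p%:R]; split=> //; last by rewrite big_seq1.
  by move=> z; rewrite inE => /eqP->; rewrite rmorph_nat.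
case: (ex_maxnP (ex_intro good 1%N good1) bnd) => k /asboolP[[|c s] [sk hs sE]] max_k.
  by have := max_k 1%N good1; rewrite -sk.
rewrite big_cons in sE.
have c0 : c != 0.
  apply/eqP => c0; have := p_neq0 J_inj.
  by rewrite -(rmorph_nat iota) -sE c0 mul0r rmorph0 eqxx.
exists c; split=> //; first by apply: hs; rewrite mem_head.
(* If [c] does not divide [d], then [c] is the product of the nonunits [d] and [c / d], and
   replacing [c] by these two lengthens the factorization. *)
move=> d sd; apply: contrapT => ncd.
have [//|[u Ou uE]] := dvO_total J_inj J_alg (iota c) (iota d).
have d0 : d != 0.
  by apply: contraNneq c0 => d0; move/eqP: uE; rewrite d0 rmorph0 mul0r fmorph_eq0.
have su : small u.
  case=> v Ov uv; apply: ncd; exists v => //.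
  by rewrite uE -mulrA -uv mulr1.
have uK : u = iota (c / d) by rewrite fmorph_div uE mulrC mulKf ?fmorph_eq0.
have : (k.+1 <= k)%N; last by rewrite ltnn.
apply: max_k; apply/asboolP; exists (d :: c / d :: s); split.
- by rewrite -sk.
- move=> z; rewrite !inE => /or3P[/eqP->//|/eqP->|zs]; first by rewrite -uK.
  by apply: hs; rewrite inE zs orbT.
- by rewrite !big_cons mulrA (mulrC d) divfK.
Qed.

End LocalField.

(** * The maximal unramified extension *)

Section Adjunction.
Variables (p : nat) (p_pr : prime p) (K : fieldExtType (padic p_pr)).
Variables (E : fieldType) (iota : {rmorphism K -> E}).

Lemma subext_adjoin (S : set E) : subext iota (adjoin iota S).
Proof.
split=> [y iy L [[iL _] _]|]; first exact: iL.
split=> [|x y /set_mem hx /set_mem hy|x y /set_mem hx /set_mem hy]; apply: mem_set.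
- by move=> L [[_ [L1 _ _]] _]; apply: set_mem.
- move=> L LS; have [[_ [_ LB _]] _] := LS; apply: set_mem.
  by apply: LB; apply: mem_set; [apply: hx | apply: hy].
- move=> L LS; have [[_ [_ _ LV]] _] := LS; apply: set_mem.
  by apply: LV; apply: mem_set; [apply: hx | apply: hy].
Qed.

Lemma divring_closedI (L M : set E) : GRing.divring_closed [in L] ->
  GRing.divring_closed [in M] -> GRing.divring_closed [in L `&` M].
Proof.
move=> [L1 LB LV] [M1 MB MV]; split=> [|x y|x y]; rewrite !in_setI.
- by rewrite L1.
- by move=> /andP[xL xM] /andP[yL yM]; rewrite LB ?MB.
- by move=> /andP[xL xM] /andP[yL yM]; rewrite LV ?MV.
Qed.

End Adjunction.

Section Unramified.
Variables (p : nat) (p_pr : prime p) (K : fieldExtType (padic p_pr)).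
Variables (Kbar : closedFieldType) (iota : {rmorphism K -> Kbar}).
Hypothesis Kbar_algebraic : forall x : Kbar, algebraicOver iota x.
Local Notation Zp := (padic_int p_pr).

Let J : {rmorphism Zp -> Kbar} := closure_emb iota.
Let J_inj : injective J := @closure_emb_inj _ _ _ _ iota.
Let J_alg := closure_emb_alg Kbar_algebraic.
Local Notation O := (integralOver J).
Local Notation dvO := (dvO J).
Local Notation small := (small J).

Lemma closure_emb_range z : range iota (J z). Proof. by exists (base_emb K z). Qed.
Let iJ := closure_emb_range.
Let char0 := natr_neq0 J_inj.

Lemma integral_iota a : integralOver (base_emb K) a <-> O (iota a).
Proof.
have e (R : {poly Zp}) : root (map_poly J R) (iota a) = root (map_poly (base_emb K)
  R) a.
  by rewrite /J /closure_emb map_poly_comp fmorph_root.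
by split=> -[R mR Ra]; exists R; rewrite // ?e // -e.
Qed.

(** An inverse in O of an element of [L] lies in [L], so the maximal ideal of O restricts to that of
    [L]. *)
Lemma max_idealP (L : set Kbar) x : GRing.divring_closed [in L] ->
  max_ideal J L x <-> L x /\ small x.
Proof.
move=> L_closed; split=> [[[Lx Ox] nx]|[Lx sx]].
  split=> // -[u Ou xu]; apply: nx; exists u => //; split=> //.
  have [L1 _ LV] := L_closed; have x0 : x != 0.
    by apply: contra_eq_neq xu => ->; rewrite mul0r oner_eq0.
  have -> : u = 1 / x by rewrite xu mulrC mulKf.
  by apply: set_mem; apply: LV => //; apply: mem_set.
split; first by split=> //; apply: small_O.
by move=> [y [_ Oy] xy]; apply: sx; exists y.
Qed.

Lemma max_ideal_base a : max_ideal (base_emb K) setT a -> small (iota a).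
Proof.
move=> [[_ Oa] na] [u Ou au]; apply: na; have a0 : a != 0.
  by apply: contra_eq_neq au => ->; rewrite rmorph0 mul0r oner_eq0.
have uE : u = iota a^-1.
  by apply: (@mulfI _ (iota a)); rewrite ?fmorph_eq0 // -au -rmorphM divff ?rmorph1.
by exists a^-1; [split=> //; apply/integral_iota; rewrite -uE | rewrite divff].
Qed.

Lemma range_closed : GRing.divring_closed [in range iota].
Proof.
split=> [|_ _ /set_mem[x _ <-] /set_mem[y _ <-]|_ _ /set_mem[x _ <-] /set_mem[y _ <-]].
- by apply/mem_set; exists 1; rewrite ?rmorph1.
- by apply/mem_set; exists (x - y); rewrite ?rmorphB.
- by apply/mem_set; exists (x / y); rewrite ?fmorph_div.
Qed.

Variable c : K.
Hypothesis c0 : c != 0.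
Hypothesis sc : small (iota c).
Hypothesis small_K : forall d, small (iota d) -> dvO (iota c) (iota d).

Lemma finite_unramified_sub_unity_ext L :
  finite_unramified iota L -> L `<=` unity_ext p iota.
Proof.
move=> [[iL L_closed] _ LE]; apply: (unramified_sub_unity_ext J_inj J_alg iJ c0 sc)
  => // x Lx sx.
have : max_ideal J L x by apply/max_idealP.
rewrite -LE => -[n [a [s [ha hs ->]]]]; apply: dvO_sum => k _.
have [_ Oa] := ha k; have /(max_idealP _ range_closed)[[d _ dE] ss] := hs k.
by apply: dvO_mull => //; rewrite -dE; apply: small_K; rewrite dE.
Qed.

Lemma sub_unity_ext_unramified L : subext iota L -> L `<=` unity_ext p iota ->
  ideal_span (integers J L) (max_ideal J (range iota)) = max_ideal J L.
Proof.
move=> [iL L_closed] Lc; apply/seteqP; split=> [_ [n [a [s [ha hs ->]]]]|x].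
  apply/max_idealP => //; split.
    have [_ LM] : GRing.mulr_closed [in L] :=
      GRing.subring_closedM (GRing.divring_closedBM L_closed).
    have [L0 LD] : GRing.nmod_closed [in L] :=
      GRing.zmod_closedD (GRing.subring_closedB (GRing.divring_closedBM L_closed)).
    apply: set_mem; elim/big_ind: _ => // k _.
    have [La _] := ha k; have [[rs _] _] := hs k.
    by apply: LM; apply: mem_set => //; apply: iL.
  apply: (small_sum J_inj J_alg) => k _; have [_ Oa] := ha k.
  by have /(max_idealP _ range_closed)[_ ss] := hs k; apply: smallMr.
move=> /(max_idealP _ L_closed)[Lx sx].
have [u Ou xE] := small_unity_ext J_inj J_alg iJ small_K (Lc x Lx) sx.
exists 1%N, (fun=> u), (fun=> iota c); split=> [k|k|]; last by rewrite big_ord1 mulrC.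
  split=> //; have [_ _ LV] := L_closed.
  have -> : u = x / iota c by rewrite xE mulrC mulKf ?fmorph_eq0.
  by apply: set_mem; apply: LV; apply: mem_set => //; apply: iL; exists c.
by apply/max_idealP; [exact: range_closed | split=> //; exists c].
Qed.

(** A finite unramified extension lies in [unity_ext]; conversely, adjoining one root of unity of
    order prime to p gives a finite unramified extension. *)
Lemma max_unramifiedE : max_unramified iota = unity_ext p iota.
Proof.
have cc := unity_ext_closed J_inj J_alg iJ.
apply/seteqP; split=> [x|x [N [z [N0 cop zN zx]]]].
  apply; split; first by split=> //; apply: range_unity_ext.
  by move=> y [L Lu Ly]; apply: finite_unramified_sub_unity_ext Ly.
have [iM M_closed] := subext_adjoin iota (\bigcup_(L in finite_unramified iota) L).
apply: (simple_ext_min M_closed iM) zx => L [_ LS]; apply: LS.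
exists (simple_ext iota z); last exact: simple_ext_id.
have gs : subext iota (simple_ext iota z).
  split; first exact: range_simple_ext.
  exact: simple_ext_closed char0 Kbar_algebraic z.
split=> //; first by have [m [b hb]] := simple_ext_basis char0 Kbar_algebraic z;
  exists m, b.
apply: sub_unity_ext_unramified => // y zy; exists N, z; split=> //.
Qed.

End Unramified.

(** * Descent along the tower *)

Section Descent.
Variables (p : nat) (p_pr : prime p) (E : closedFieldType).
Local Notation Zp := (padic_int p_pr).
Variable J : {rmorphism Zp -> E}.
Hypothesis J_inj : injective J.
Hypothesis J_alg : forall x : E, exists2 P : {poly Zp}, P != 0 & root (map_poly J P) x.
Local Notation O := (integralOver J).
Local Notation dvO := (dvO J).
Local Notation small := (small J).

(** One of [x], [y] divides the other, so x + y is a multiple of one of them and the exponent is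
    kept, which a binomial expansion would not give. *)
Lemma dvO_expD a x y n : dvO a (x ^+ n) -> dvO a (y ^+ n) -> dvO a ((x + y) ^+ n).
Proof.
move=> ax ay; have [[u Ou ->]|[u Ou ->]] := dvO_total J_inj J_alg x y.
  rewrite -[X in X + _]mulr1 -mulrDr exprMn; apply: dvO_mulr => //.
  by apply: integral_exp; apply: integral_add => //; apply: integral1.
rewrite -[X in _ + X]mulr1 -mulrDr exprMn; apply: dvO_mulr => //.
by apply: integral_exp; apply: integral_add => //; apply: integral1.
Qed.

Lemma dvO_expB a x y n : dvO a (x ^+ n) -> dvO a (y ^+ n) -> dvO a ((x - y) ^+ n).
Proof.
move=> ax ay; apply: dvO_expD => //; rewrite -mulN1r exprMn.
by apply: dvO_mull => //; apply: integral_exp; apply: integral_opp; apply: integral1.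
Qed.

Lemma integral_taylor (A : {poly E}) x y : (forall k, O A`_k) -> O x -> O y ->
  exists2 g, O g & A.[x] - A.[y] = (x - y) * (A^`().[y] + (x - y) * g).
Proof.
move=> + Ox Oy; elim/poly_ind: A => [|A b IH] OA.
  by exists 0; rewrite ?derivC ?horner0 ?subrr ?mulr0 ?addr0 ?mulr0 //;
    apply: integral0.
have {}OA k : O A`_k by have := OA k.+1; rewrite coefD coefMX coefC addr0.
have [g Og gE] := IH OA.
have OA' : O A^`().[y].
  apply: integral_horner => //; apply/integral_poly => k.
  by rewrite coef_deriv -mulr_natr; apply: integral_mul => //; apply: integral_nat.
exists (A^`().[y] + g * x); first by apply: integral_add => //; apply: integral_mul.
rewrite derivD derivM derivX derivC addr0 mulr1 !hornerMXaddC hornerD hornerMX.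
have -> : A.[x] = A.[y] + (x - y) * (A^`().[y] + (x - y) * g) by rewrite -gE addrC
  subrK.
ring.
Qed.

(* With [f' = 0 mod a], Taylor expansion gives [f x - f y = (x - y) w], where
   [w] is in the ideal generated by [a] and [x - y]. *)
Lemma descent_step (A : {poly E}) a x y n : (0 < n)%N ->
    (forall k, O A`_k) -> (forall k, dvO a A^`()`_k) -> O a -> O x -> O y ->
    dvO a ((x - y) ^+ n) ->
  exists2 w, dvO a (w ^+ n) & A.[x] - A.[y] = (x - y) * w.
Proof.
move=> n0 OA aA Oa Ox Oy axy; have [g Og ->] := integral_taylor OA Ox Oy.
exists (A^`().[y] + (x - y) * g) => //; apply: dvO_expD; last first.
  by rewrite exprMn; apply: dvO_mulr => //; apply: integral_exp.
have : dvO a A^`().[y].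
  by rewrite horner_coef; apply: dvO_sum => k _; apply: dvO_mulr => //;
    apply: integral_exp.
move=> /(dvO_exp n); apply: dvO_trans; exact: (@dvO_expl _ _ _ _ a 1 n).
Qed.

Section Tower.
Variables (F : fieldType) (i : {rmorphism F -> E}) (f : {poly F}) (c : F).
Local Notation "Q ^i" := (map_poly i Q) (at level 2, format "Q ^i").
Hypothesis iJ : forall z, range i (J z).
Hypothesis sc : small (i c).
Hypothesis small_F : forall d, small (i d) -> dvO (i c) (i d).
Hypothesis residue_F : forall y, O y -> exists d, small (y - i d).
Hypothesis f_integral : forall k, O f^i`_k.
Hypothesis f'_dvO : forall k, dvO (i c) (f^i)^`()`_k.
Variable t : nat -> E.
Hypothesis t_integral : forall n, O (t n).
Hypothesis t_S : forall n, f^i.[t n.+1] = t n.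
Variable B : nat.
Hypothesis B_gt0 : (0 < B)%N.
Hypothesis t_degree : forall n, exists Q : {poly F},
  [/\ Q != 0, (size Q <= B.+1)%N & root Q^i (t n)].

Fixpoint iter_poly k : {poly F} := if k is l.+1 then f \Po iter_poly l else 'X.

Lemma horner_iter_poly k n : (iter_poly k)^i.[t (k + n)%N] = t n.
Proof.
elim: k n => [|k IH] n /=; first by rewrite map_polyX hornerX.
by rewrite map_comp_poly horner_comp addSnnS IH t_S.
Qed.

(** The small element t_n - d is a root of Q(X + d), which has the same degree as Q. *)
Lemma center n : exists d, dvO (i c) ((t n - i d) ^+ B).
Proof.
have [d sd] := residue_F (t_integral n); exists d.
have [Q [Q0 sQ Qt]] := t_degree n.
have sX : size ('X + d%:P) = 2 by rewrite size_XaddC.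
apply: (dvO_pow_of_root J_inj J_alg small_F (Q := Q \Po ('X + d%:P))) => //.
- by rewrite -size_poly_eq0 size_comp_poly2 // size_poly_eq0.
- by rewrite size_comp_poly2.
- rewrite rootE map_comp_poly horner_comp rmorphD /= map_polyX map_polyC hornerD
  hornerX hornerC /=.
  by rewrite subrK -rootE.
Qed.

(* [D ^ B] is divisible by every power of [c], because some conjugate of [t n]
   different from [t n] is the image of a conjugate of [t (N + n)]. *)
Lemma tower_in_base n : range i (t n).
Proof.
apply: contrapT => ntn.
have char0 := natr_neq0 J_inj; have i_alg := algebraic_base J_inj J_alg iJ.
have Oc : O (i c) by apply: small_O.
have [P0 [rs0 min0]] := minpoly_exists char0 i_alg (t n).
have [_ Urs0 _ _] := min0.
(* The conjugate of [t n] reached from level N + n depends on N; the product over all of them is a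
   single quantity that every N can bound. *)
pose D := \prod_(r <- rs0 | r != t n) (r - t n).
have : D ^+ B != 0.
  rewrite expf_neq0 // prodf_seq_neq0; apply/allP => r _.
  by apply/implyP; rewrite subr_eq0.
move/eqP; apply; apply: (dvO_smallX_eq0 J_inj J_alg sc) => N.
have [P [rs minP]] := minpoly_exists char0 i_alg (t (N + n)%N).
(* Otherwise the N-th iterate of [f] takes the value [t n] at every conjugate of [t (N + n)], and
   [t n] lies in the base. *)
have [s [srs sN]] : exists s, s \in rs /\ (iter_poly N)^i.[s] != t n.
  apply: contrapT => h; apply: ntn; rewrite -(horner_iter_poly N n).
  apply: (minpoly_conj_const minP) => r rrs; rewrite horner_iter_poly.
  by apply: contrapT => /eqP ne; apply: h; exists r.
pose sk k := (iter_poly k)^i.[s].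
have Osk k : O (sk k).
  elim: k => [|k IH]; rewrite /sk /=.
    apply: (conj_O iJ minP srs); rewrite map_polyX hornerX.
    exact: t_integral.
  rewrite map_comp_poly horner_comp.
  by apply: integral_horner => //; apply/integral_poly.
have near k : (k <= N)%N -> dvO (i c) ((sk k - t (N - k + n)%N) ^+ B).
  move=> kN; have [d hd] := center (N - k + n)%N.
  have e r : ((iter_poly k - d%:P) ^+ B)^i.[r] = ((iter_poly k)^i.[r] - i d) ^+ B.
    by rewrite rmorphXn rmorphB /= map_polyC horner_exp hornerD hornerN hornerC.
  have sd : dvO (i c) ((sk k - i d) ^+ B).
    rewrite -e; apply: (conj_dvO iJ minP srs); rewrite e.
    by rewrite -[in t _](subnKC kN) -addnA horner_iter_poly.
  have -> : sk k - t (N - k + n)%N = (sk k - i d) - (t (N - k + n)%N - i d) by ring.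
  exact: dvO_expB.
have desc k : (k <= N)%N -> dvO (i c ^+ k) ((sk k - t (N - k + n)%N) ^+ B).
  elim: k => [|k IH] kN.
    by rewrite expr0; apply/dvO1; apply: integral_exp; apply: integral_sub.
  have [w aw wE] := descent_step B_gt0 f_integral f'_dvO Oc (Osk k) (t_integral _)
    (near k (ltnW kN)).
  have -> : sk k.+1 - t (N - k.+1 + n)%N = (sk k - t (N - k + n)%N) * w.
    rewrite -wE {1}/sk /= map_comp_poly horner_comp; congr (_ - _).
    by rewrite -[in RHS](subnSK kN) addSn t_S.
  by rewrite exprMn exprSr; apply: dvOM => //; apply: IH; apply: ltnW.
have sN0 : sk N \in rs0.
  rewrite -(root_minpoly min0) rootE -horner_comp -map_comp_poly -rootE.
  apply: (minpoly_conj minP srs);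
    rewrite rootE map_comp_poly horner_comp horner_iter_poly.
  by rewrite -rootE (root_minpoly min0); have [_ _ ->] := min0.
rewrite /D -big_filter (bigD1_seq (sk N)) ?mem_filter ?filter_uniq ?sN0 ?andbT //=.
rewrite exprMn; apply: dvO_mulr; first by have := desc N (leqnn N); rewrite subnn add0n.
apply: integral_exp; rewrite big_seq_cond; apply: integral_prod => r.
rewrite mem_filter => /andP[/andP[_ rrs0] _]; apply: integral_sub => //.
rewrite -[r]hornerX -(map_polyX i); apply: (conj_O iJ min0) => //.
by rewrite map_polyX hornerX.
Qed.

End Tower.
End Descent.

(** * From the degree of an extension to an annihilating polynomial over a larger base *)

Section DegreeBound.
Variables (p : nat) (p_pr : prime p) (K : fieldExtType (padic p_pr)).
Variables (Kbar : closedFieldType) (iota : {rmorphism K -> Kbar}).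
Hypothesis Kbar_algebraic : forall x : Kbar, algebraicOver iota x.

(** An equation of [x] over the intersection of [L] and [M] is also an equation over [M]. With [M] =
    K^ur this turns the bound on e_n into a bound on the degree of t_n over K^ur. *)
Lemma degree_annihilator (M : set Kbar) (x : Kbar) :
    GRing.divring_closed [in M] -> range iota `<=` M ->
  let L := adjoin iota [set x] in
  exists (F : fieldType) (i : {rmorphism F -> Kbar}) (Q : {poly F}),
    [/\ range i `<=` M, Q != 0, (size Q <= (degree (L `&` M) L).+1)%N & root
      (map_poly i Q) x].
Proof.
move=> M_closed iM L; have [iL L_closed] := subext_adjoin iota [set x].
have Lx : L x by move=> S [_]; apply.
have [F [i iE]] := subfield_embedding (divring_closedI L_closed M_closed).
have J_inj : injective (closure_emb iota) := @closure_emb_inj _ _ _ _ iota.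
have ioi : range iota `<=` range i by rewrite iE => y iy; split;
  [exact: iL | exact: iM].
have char0 := natr_neq0 J_inj.
have i_alg := algebraic_base J_inj (closure_emb_alg Kbar_algebraic)
  (fun z => ioi _ (closure_emb_range iota z)).
have LE : L = simple_ext i x.
  apply/seteqP; split; last by apply: simple_ext_min => //; rewrite iE => y [].
  move=> y; apply; split; last by move=> _ ->; apply: simple_ext_id.
  split; last exact: simple_ext_closed char0 i_alg x.
  exact: subset_trans ioi (@range_simple_ext _ _ i x).
(* The power basis shows that some basis exists, so [degree] is the size of an actual basis and not
   its default value 0. *)
have [b hb] : exists b : 'I_(degree (L `&` M) L) -> Kbar, is_basis (range i) L b.
  rewrite iE; apply: (@xgetPex _ 0%N [set m | exists b : 'I_m -> Kbar,
    is_basis (L `&` M) L b]).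
  have [m [b]] := simple_ext_basis char0 i_alg x; rewrite -LE iE => hb.
  by exists m, b.
have [Q [Q0 sQ Qx]] := basis_annihilator L_closed Lx hb.
by exists F, i, Q; split=> //; rewrite iE => y [].
Qed.

End DegreeBound.
Unset Implicit Arguments.

Theorem proposition3p1 (p : nat) (p_pr : prime p)
    (K : fieldExtType (padic p_pr))
    (Kbar : closedFieldType) (iota : {rmorphism K -> Kbar})
    (Kbar_algebraic : forall x : Kbar, algebraicOver iota x)
    (d : nat) (d_ge2 : (2 <= d)%N)
    (f : {poly K})
    (f_integral : forall i, integers (base_emb K) setT f`_i)
    (f_monic : f \is monic) (f_degree : size f = d.+1)
    (f'_max_ideal : forall i, max_ideal (base_emb K) setT (f^`())`_i)
    (t0 : K) (t0_integral : integers (base_emb K) setT t0)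
    (t : nat -> Kbar) (t_0 : t 0%N = iota t0)
    (t_S : forall n, (map_poly iota f).[t n.+1] = t n) :
  let Kn n := adjoin iota [set t n] in
  let Kinf := \bigcup_n Kn n in
  let En n := Kn n `&` max_unramified iota in
  let e n := degree (En n) (Kn n) in
  ~ unramified iota Kinf ->
  forall B : nat, exists n : nat, (B < e n)%N.
Proof.
move=> Kn Kinf En e ram B; apply: contrapT => /forallNP hB.
have {hB} eB n : (e n <= B)%N by rewrite leqNgt; apply/negP/hB.
apply: ram => L L_subext L_finite LK; split=> //.
have J_inj : injective (closure_emb iota) := @closure_emb_inj _ _ _ _ iota.
have J_alg := closure_emb_alg Kbar_algebraic.
have [c [c0 sc small_K]] := uniformizer_exists Kbar_algebraic.
have iJ := closure_emb_range iota.
have uE := max_unramifiedE Kbar_algebraic c0 sc small_K.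
have cc := unity_ext_closed J_inj J_alg iJ.
have icyc : range iota `<=` unity_ext p iota by apply: range_unity_ext.
have [F [i iE]] := subfield_embedding cc.
have ioi : range iota `<=` range i by rewrite iE.
(* K^ur is a field containing K, so it contains K_n as soon as it contains t_n; every finite [L]
   inside the tower then lies in K^ur. *)
suff tcyc n : unity_ext p iota (t n).
  apply: (sub_unity_ext_unramified Kbar_algebraic c0 sc small_K L_subext) => x /LK[n _].
  by apply; split=> // _ ->; apply: tcyc.
have [fF fFE] := lift_poly ioi f.
have [c' _ c'E] : range i (iota c) by apply: ioi; exists c.
have f_O k : integralOver (closure_emb iota) (iota f`_k).
  by have [_ Of] := f_integral k; apply/integral_iota.
have t_O m : integralOver (closure_emb iota) (t m).
  elim: m => [|m IH]; first by rewrite t_0; have [_ Ot] := t0_integral;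
    apply/integral_iota.
  have sf : (size (- (t m)%:P) < size (map_poly iota f))%N.
    by rewrite size_polyN size_map_poly f_degree (leq_ltn_trans (size_polyC_leq1 _))
      // ltnS ltnW.
  apply: (@integral_root_monic _ _ _ _ (map_poly iota f - (t m)%:P)).
  - by rewrite monicE lead_coefDl // lead_coef_map (monicP f_monic) rmorph1.
  - by rewrite rootE hornerD hornerN hornerC t_S subrr.
  apply/integral_poly => k; rewrite coefB coef_map coefC; apply: integral_sub;
    first exact: f_O.
  by case: ifP => _ //; apply: integral0.
(* The descent is run with [B.+1] as degree bound, since it requires a positive exponent and [B] may
   be 0. *)
rewrite -iE; apply: (tower_in_base J_inj J_alg (f := fF) (c := c') _ _ _ _ _ _ _ _
  (ltn0Sn B)) => //.
- by move=> z; apply: ioi; apply: iJ.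
- by rewrite c'E.
- move=> a sa; rewrite c'E; apply: (small_unity_ext J_inj J_alg iJ small_K) => //.
  by rewrite -iE; exists a.
- move=> y Oy; have [sy|[N [z [N0 cop zN syz]]]] := residue_root_of_unity J_inj J_alg
  Oy.
    by exists 0; rewrite rmorph0 subr0.
  have [a _ aE] : range i z by rewrite iE; apply: root_of_unity_ext zN.
  by exists a; rewrite aE.
- by move=> k; rewrite fFE coef_map; apply: f_O.
- move=> k; rewrite fFE deriv_map coef_map /= c'E; apply: small_K.
  exact: max_ideal_base.
- by move=> m; rewrite fFE.
move=> m; have := degree_annihilator Kbar_algebraic (t m) cc icyc.
rewrite -uE => -[F1 [i1 [Q1 [i1M Q10 sQ1 Q1t]]]].
have [Q QE] : exists Q : {poly F}, map_poly i Q = map_poly i1 Q1.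
  by apply: lift_poly; rewrite iE -uE.
exists Q; rewrite QE -(map_poly_eq0 i) -(size_map_poly i) QE map_poly_eq0 size_map_poly.
split=> //; apply: leq_trans sQ1 _; rewrite ltnS; apply: leqW; exact: eB.
Qed.
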